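(* Let $p$ be a prime and let $G$ be a finitely presented group. Suppose that $G$ has a presentation $\langle X|R\rangle$ with $X$ finite and $\mathrm{def}_p(G;X,R)>1$. Then $G$ is $p$-large.
   Context: For a presentation $\langle X|R\rangle$ of $G$ with $X$ finite and $R$ a subset (finite or infinite) of the free group $F(X)$, the $p$-deficiency is $\mathrm{def}_p(G;X,R)=|X|-\sum_{r\in R}p^{-\nu_p(r)}$, where $\nu_p(r)=\max\{k\ge 0 : \exists w\in F(X),\ w^{p^k}=r\}$; if $R$ is infinite and the sum does not converge, then $\mathrm{def}_p(G;X,R)=-\infty$. A group $G$ is $p$-large if some normal subgroup of $G$ of index a power of $p$ admits a non-abelian free quotient. *)

(* Defs.v *)
From HB Require Import structures.
From mathcomp Require Import all_boot all_order all_algebra.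
From mathcomp Require Import all_classical all_reals all_analysis.

Set Implicit Arguments.
Unset Strict Implicit.
Unset Printing Implicit Defensive.

Import Order.TTheory GRing.Theory Num.Theory.

Local Open Scope classical_set_scope.

(** * Free groups as reduced words *)

Section ReducedWords.
Context {X : eqType}.

(* [(x, true)] stands for the letter x and [(x, false)] for its inverse. *)
Local Notation letter := (X * bool)%type.

Implicit Types (a b : letter) (u v w : seq letter).

Definition letter_inv a : letter := (a.1, ~~ a.2).

Definition reduced w : bool := sorted (fun a b => b != letter_inv a) w.

Definition push a w : seq letter :=
  if w is b :: w' then if b == letter_inv a then w' else a :: w else [:: a].

(* Free reduction of the concatenation u ++ v, for v reduced. *)
Definition word_mul u v : seq letter := foldr push v u.

Definition word_inv w : seq letter := rev (map letter_inv w).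

Lemma letter_invK : involutive letter_inv.
Proof. by case=> x b; rewrite /letter_inv /= negbK. Qed.

Lemma letter_inv_neq a : letter_inv a != a.
Proof. by case: a => x b; rewrite /letter_inv xpair_eqE /= eqxx; case: b. Qed.

Lemma reduced_push a w : reduced w -> reduced (push a w).
Proof.
case: w => [//|b w] /= rw; case: ifPn => [_|nab]; first exact: path_sorted rw.
by rewrite /= nab.
Qed.

Lemma reduced_word_mul u v : reduced v -> reduced (word_mul u v).
Proof. by move=> rv; elim: u => [//|a u IH] /=; apply: reduced_push. Qed.

Lemma push_invK a w : reduced w -> push a (push (letter_inv a) w) = w.
Proof.
case: w => [_|b w] /=; first by rewrite eqxx.
rewrite letter_invK; case: (eqVneq b a) => [->|nba] rw; last by rewrite /= eqxx.
by case: w rw => [//|c w] /= /andP[/negPf-> _].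
Qed.

Lemma word_mul_push a u w :
  reduced w -> word_mul (push a u) w = push a (word_mul u w).
Proof.
case: u => [//|b u] rw /=; case: eqP => [->|//].
by rewrite push_invK //; apply: reduced_word_mul.
Qed.

Lemma word_mulA u v w :
  reduced w -> word_mul u (word_mul v w) = word_mul (word_mul u v) w.
Proof. by move=> rw; elim: u => [//|a u IH] /=; rewrite word_mul_push // IH. Qed.

Lemma word_mulw1 u : reduced u -> word_mul u [::] = u.
Proof.
elim: u => [//|a u IH] /= ru; rewrite IH; last exact: path_sorted ru.
by case: u ru {IH} => [//|b u] /= /andP[/negPf->].
Qed.

Lemma reduced_word_inv w : reduced w -> reduced (word_inv w).
Proof.
rewrite /reduced /word_inv rev_sorted sorted_map; apply: sub_sorted => a b /=.
by rewrite letter_invK eq_sym.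
Qed.

Lemma word_invK : involutive word_inv.
Proof. by move=> w; rewrite /word_inv map_rev revK (mapK letter_invK). Qed.

Lemma word_mulVw w : word_mul (word_inv w) w = [::].
Proof.
elim: w => [//|a w IH]; rewrite /word_inv /word_mul map_cons rev_cons foldr_rcons.
by rewrite /= letter_invK eqxx; apply: IH.
Qed.

End ReducedWords.

Record freeGroup (X : choiceType) : Type :=
  FreeGroup { word_of :> seq (X * bool); _ : reduced word_of }.

HB.instance Definition _ (X : choiceType) := [isSub for @word_of X].
HB.instance Definition _ (X : choiceType) := [Choice of freeGroup X by <:].

Section FreeGroupLaw.
Context {X : choiceType}.
Implicit Types u v w : freeGroup X.

Definition free_one : freeGroup X := FreeGroup (isT : reduced [::]).

Definition free_mul u v : freeGroup X :=
  FreeGroup (reduced_word_mul u (valP v)).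

Definition free_inv u : freeGroup X := FreeGroup (reduced_word_inv (valP u)).

Definition free_gen (x : X) : freeGroup X :=
  FreeGroup (isT : reduced [:: (x, true)]).

Lemma free_mulA : associative free_mul.
Proof. by move=> u v w; apply/val_inj/word_mulA/(valP w). Qed.

Lemma free_mul1w : left_id free_one free_mul.
Proof. by move=> u; apply/val_inj. Qed.

Lemma free_mulw1 : right_id free_one free_mul.
Proof. by move=> u; apply/val_inj/word_mulw1/(valP u). Qed.

Lemma free_mulVw : left_inverse free_one free_inv free_mul.
Proof. by move=> u; apply/val_inj/word_mulVw. Qed.

Lemma free_mulwV : right_inverse free_one free_inv free_mul.
Proof.
by move=> u; apply/val_inj; rewrite /= -{1}[val u]word_invK; apply: word_mulVw.
Qed.

End FreeGroupLaw.

HB.instance Definition _ (X : choiceType) :=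
  isGroup.Build (freeGroup X) (@free_mulA X) (@free_mul1w X) (@free_mulw1 X)
    (@free_mulVw X) (@free_mulwV X).

(** * Presentations and p-deficiency *)

Local Open Scope ring_scope.
Local Open Scope group_scope.

Definition normal_subgroup (G : groupType) (H : set G) : Prop :=
  group_closed [in H] /\ forall g x : G, H x -> H (x ^ g).

Definition normal_closure (G : groupType) (A : set G) : set G :=
  smallest (@normal_subgroup G) A.

Definition presented_by (G : groupType) (X : choiceType)
    (R : set (freeGroup X)) : Prop :=
  exists f : {multiplicative freeGroup X -> G},
    range f = [set: G] /\ f @^-1` [set 1] = normal_closure R.

Definition finitely_presented (G : groupType) : Prop :=
  exists (X : finType) (R : set (freeGroup X)),
    finite_set R /\ presented_by G R.

(* For p > 1 the maximum exists exactly when r is not 1; [xget] returns the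
   default value 0 for r = 1. *)
Definition nu (p : nat) (X : choiceType) (r : freeGroup X) : nat :=
  let E := [set k : nat | exists w : freeGroup X, w ^+ (p ^ k)%N = r] in
  xget 0%N [set k | E k /\ forall j, E j -> (j <= k)%N].

(* The trivial relator is a p^k-th power for every k: its weight p^-oo is 0. *)
Definition relator_weight (K : realType) (p : nat) (X : choiceType)
    (r : freeGroup X) : K :=
  if r == 1 then 0%R else (p%:R ^- nu p r)%R.

(* The value is -oo when the sum of the weights diverges. *)
Definition pdeficiency (K : realType) (p : nat) (X : finType)
    (R : set (freeGroup X)) : \bar K :=
  (#|X|%:R%:E - \esum_(r in R) (relator_weight K p r)%:E)%E.

(** * p-large groups *)

Definition left_cosets (G : groupType) (H : set G) : set (set G) :=
  [set [set g * h | h in H] | g in [set: G]].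

Definition has_index (G : groupType) (H : set G) (n : nat) : Prop :=
  (left_cosets H #= `I_n)%card.

(* A homomorphism from the subgroup H is encoded by a map on G which is
   multiplicative on H; its values outside H are irrelevant. *)
Definition has_nonabelian_free_quotient (G : groupType) (H : set G) : Prop :=
  exists (Y : choiceType) (f : G -> freeGroup Y),
    [/\ {in H &, {morph f : x y / x * y}},
        f @` H = [set: freeGroup Y] &
        exists a b : freeGroup Y, a * b <> b * a].

Definition plarge (p : nat) (G : groupType) : Prop :=
  exists (H : set G) (n : nat),
    [/\ normal_subgroup H, has_index H (p ^ n)%N &
        has_nonabelian_free_quotient H].

(* Main.v *)
(* Finitely many relators w_i^(p^k_i) suffice. Choose a finite p-quotient Q of
   the free group F(X), killing all of them, in which the orders of the w_i are
   as large as possible, and keep the relators for which w_i has order exactly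
   p^k_i. A Frattini argument shows that every finite p-quotient killing the kept
   relators kills all of them. The kept relators have |Q| / p^k_i orbits of lifts
   to the Cayley graph of Q, so def_p > 1 says that the kernel of F(X) -> Q
   behaves like a group of deficiency at least 2, and the Baumslag-Pride argument
   applies. A linear system over the rationals gives a non-trivial integral
   cocycle c on the Cayley graph. In the cyclic cover of large degree n = p^k
   defined by c, a linear system over F_p gives a cocycle d which kills the
   relators, vanishes near level 0 and is non-trivial away from level 0. In the
   p-fold cover defined by d, label by the j-th generator of a free group of rank
   p the crossings of level 0 on the sheet j. A relator either stays away from
   level 0 or stays on one sheet with no net crossing; hence the labels define a
   map onto this free group from a stabilizer in G. Passing to the kernel of the
   finite action replaces the free group by a subgroup D of finite index, which
   again maps onto a free group of rank p. *)

Require Import Defs.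
From HB Require Import structures.
From mathcomp Require Import all_boot all_order all_algebra all_fingroup all_solvable.
From mathcomp Require Import all_classical all_reals all_analysis.
From mathcomp Require Import zify.

Set Implicit Arguments.
Unset Strict Implicit.
Unset Printing Implicit Defensive.

Import Order.TTheory GRing.Theory Num.Theory GroupScope.

Local Open Scope classical_set_scope.

(** * Actions of free groups *)

(* All actions are right actions, given by the action of the letters. *)
Section Action.
Context {X : choiceType} {T : Type} (step : T -> X * bool -> T).
Hypothesis stepK : forall t a, step (step t a) (letter_inv a) = t.
Implicit Types (t : T) (w : seq (X * bool)) (u v : freeGroup X).

Definition wact t w : T := foldl step t w.

Lemma wact_cat t w1 w2 : wact t (w1 ++ w2) = wact (wact t w1) w2.
Proof. exact: foldl_cat. Qed.

Lemma wact_push t a w : wact t (push a w) = wact (step t a) w.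
Proof. by case: w => //= b w; case: eqP => //= ->; rewrite stepK. Qed.

Lemma wact_word_mul t w1 w2 : wact t (word_mul w1 w2) = wact (wact t w1) w2.
Proof. by elim: w1 t => //= a w1 IH t; rewrite wact_push IH. Qed.

Lemma wactM t u v : wact t (u * v) = wact (wact t u) v.
Proof. exact: wact_word_mul. Qed.

Lemma wactK t u : wact (wact t u) (u^-1 : freeGroup X) = t.
Proof. by rewrite -wactM mulgV. Qed.

Lemma wactVK t u : wact (wact t (u^-1 : freeGroup X)) u = t.
Proof. by rewrite -wactM mulVg. Qed.

Lemma wact_fixX t u n : wact t u = t -> wact t (u ^+ n : freeGroup X) = t.
Proof. by move=> h; elim: n => [//|n IH]; rewrite expgS wactM h. Qed.

End Action.

Definition reduce {X : choiceType} (w : seq (X * bool)) : freeGroup X :=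
  FreeGroup (reduced_word_mul w (isT : reduced [::])).

Lemma wact_reduce (X : choiceType) (T : Type) (step : T -> X * bool -> T) t w :
  (forall t a, step (step t a) (letter_inv a) = t) ->
  wact step t (reduce w) = wact step t w.
Proof. by move=> stepK; rewrite (wact_word_mul stepK). Qed.

Lemma wact_equiv (X : choiceType) (T T' : Type) (step : T -> X * bool -> T)
    (step' : T' -> X * bool -> T') (h : T -> T') t w :
  (forall t a, h (step t a) = step' (h t) a) ->
  h (wact step t w) = wact step' (h t) w.
Proof. by move=> hS; elim: w t => //= a w IH t; rewrite IH hS. Qed.

Section Letters.
Context {X : choiceType}.

Definition free_letter (a : X * bool) : freeGroup X :=
  FreeGroup (isT : reduced [:: a]).

Lemma free_letterV a : free_letter (letter_inv a) = (free_letter a)^-1.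
Proof. exact/val_inj. Qed.

Lemma freeGroup_ind (P : freeGroup X -> Prop) :
  P 1 -> (forall a u, P u -> P (free_letter a * u)) -> forall u, P u.
Proof.
move=> P1 PM [w rw]; elim: w rw => [|a w IH] raw.
  by have -> : FreeGroup raw = 1 by exact/val_inj.
have rw : reduced w by exact: path_sorted raw.
have -> : FreeGroup raw = free_letter a * FreeGroup rw; last exact/PM/IH.
apply/val_inj => /=; case: (w) raw => //= b w' /andP[/negPf-> _] //.
Qed.

Lemma subgroup_free_full (D : set (freeGroup X)) :
  group_closed [in D] -> (forall x, D (free_gen x)) -> forall u, D u.
Proof.
move=> Dg Dx; have D1 : D 1 by case: Dg => /set_mem.
have DM u v : D u -> D v -> D (u * v).
  by move=> Du Dv; apply/set_mem/(group_closedM Dg); apply/mem_set.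
have DV u : D u -> D u^-1.
  by move=> Du; apply/set_mem/(group_closedV Dg); apply/mem_set.
apply: freeGroup_ind => // -[x b] u Du; apply: DM => //.
case: b; first exact: Dx.
have -> : free_letter (x, false) = (free_gen x)^-1 by exact/val_inj.
exact/DV/Dx.
Qed.

End Letters.

(** * Homomorphisms out of a free group *)

Section FreeLift.
Context {X : choiceType} {G : groupType} (f : X -> G).

Definition lift_letter (a : X * bool) : G := if a.2 then f a.1 else (f a.1)^-1.

Definition lift_step (g : G) a : G := g * lift_letter a.

Lemma lift_stepK g a : lift_step (lift_step g a) (letter_inv a) = g.
Proof. by case: a => x [] /=; rewrite /lift_step /= ?mulgK ?mulgVK. Qed.

Definition free_lift (u : freeGroup X) : G := wact lift_step 1 u.

Lemma wact_lift_step g w : wact lift_step g w = g * wact lift_step 1 w.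
Proof.
elim: w g => [|a w IH] g /=; first by rewrite mulg1.
by rewrite IH [in RHS]IH /lift_step mul1g mulgA.
Qed.

Lemma free_liftM : {morph free_lift : u v / u * v}.
Proof.
by move=> u v; rewrite /free_lift (wactM lift_stepK) wact_lift_step.
Qed.

Lemma free_lift_gen x : free_lift (free_gen x) = f x.
Proof. exact: mul1g. Qed.

End FreeLift.

Lemma morph1_id (G H : groupType) (f : G -> H) :
  {morph f : x y / x * y} -> f 1 = 1.
Proof. by move=> fM; apply: (@mulgI _ (f 1)); rewrite -fM !mulg1. Qed.

Lemma morph_inv (G H : groupType) (f : G -> H) :
  {morph f : x y / x * y} -> {morph f : x / x^-1}.
Proof.
by move=> fM x; apply/esym/mulg1_eq; rewrite -fM mulgV (morph1_id fM).
Qed.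

Lemma morph_exp (G H : groupType) (f : G -> H) n :
  {morph f : x y / x * y} -> {morph f : x / x ^+ n}.
Proof.
by move=> fM x; elim: n => [|n IH]; rewrite ?(morph1_id fM)// !expgS fM IH.
Qed.

Lemma free_morph_ext (X : choiceType) (H : groupType) (f g : freeGroup X -> H) :
  {morph f : x y / x * y} -> {morph g : x y / x * y} ->
  (forall x, f (free_gen x) = g (free_gen x)) -> f =1 g.
Proof.
move=> fM gM fg; apply: subgroup_free_full => //; split.
  by apply/mem_set; rewrite (morph1_id fM) (morph1_id gM).
move=> u v /set_mem fu /set_mem fv; apply/mem_set => /=.
by rewrite fM gM (morph_inv fM) (morph_inv gM) fu fv.
Qed.

(** * The permutation representation of an action on a finite set *)

Section PermRep.
Context {X : choiceType} {T : finType} (step : T -> X * bool -> T).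
Hypothesis stepK : forall t a, step (step t a) (letter_inv a) = t.

Lemma wact_inj (u : freeGroup X) : injective (wact step ^~ u).
Proof. by apply: (can_inj (g := wact step ^~ (u^-1 : freeGroup X))) => t; exact: wactK. Qed.

Definition wperm (u : freeGroup X) : {perm T} := perm (@wact_inj u).

Lemma wpermE u t : wperm u t = wact step t u.
Proof. by rewrite permE. Qed.

Lemma wpermM : {morph wperm : u v / u * v}.
Proof. by move=> u v; apply/permP => t; rewrite permM !wpermE (wactM stepK). Qed.

Lemma wperm1P u : wperm u = 1 <-> forall t, wact step t u = t.
Proof.
split=> [h t|h]; first by rewrite -wpermE h perm1.
by apply/permP => t; rewrite wpermE perm1.
Qed.

End PermRep.

(** * Finite p-quotients *)

Lemma pgroup_p_elt (Q : finGroupType) (G : {group Q}) (p : nat) :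
  (forall x, x \in G -> p.-elt x) -> p.-group G.
Proof.
move=> pG; apply/pgroupP => q q_pr /(Cauchy q_pr)[x xG xq].
by have := pG x xG; rewrite /p_elt xq pnatE.
Qed.

(** Replaces the target by the image of [phi], a p-group because all its elements have p-power
    order. Orders and kernel are preserved, so statements about relators carry over. *)
Lemma corestriction (F : groupType) (Q : finGroupType) (phi : F -> Q) (p : nat) :
  {morph phi : x y / x * y} -> (forall u, p.-elt (phi u)) ->
  exists (Q' : finGroupType) (phi' : F -> Q'),
    [/\ {morph phi' : x y / x * y}, p.-group [set: Q']%SET,
        (forall q, exists u, phi' u = q), (forall u, #[phi' u] = #[phi u])
        & forall u, phi' u = 1 <-> phi u = 1].
Proof.
move=> phiM p_phi; pose A := [set x : Q | `[< exists u, phi u = x >]]%SET.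
have AP x : reflect (exists u, phi u = x) (x \in A) by rewrite inE; exact: asboolP.
have gA : group_set A.
  apply/group_setP; split; first by apply/AP; exists 1; exact: morph1_id.
  by move=> x y /AP[u <-] /AP[v <-]; apply/AP; exists (u * v); rewrite phiM.
pose G := group gA; have GP u : phi u \in G by apply/AP; exists u.
have oG u : #[subg G (phi u)] = #[phi u].
  by rewrite -[in RHS](@subgK _ G _ (GP u)) (order_injm (injm_sgval G)) ?inE.
have onto q : exists u, subg G (phi u) = q.
  by have /AP[u qu] := subgP q; exists u; rewrite qu; exact: sgvalK.
exists (subg_of G), (fun u => subg G (phi u)); split => //.
- by move=> u v; rewrite phiM subgM.
- by apply: pgroup_p_elt => q _; have [u <-] := onto q; rewrite /p_elt oG; exact: p_phi.
- move=> u; split=> [|->]; last exact: morph1.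
  by move=> h; rewrite -[LHS](@subgK _ G _ (GP u)) h.
Qed.

(** The root and the exponent are stored separately because the order of the image of the root
    decides whether a relator is kept. *)
Definition relator (F : groupType) (p : nat) (r : F * nat) : F := r.1 ^+ (p ^ r.2).

Definition kills (F H : groupType) (p : nat) (phi : F -> H) (s : seq (F * nat)) :=
  forall r, r \in s -> phi (relator p r) = 1.

Definition is_pquotient (p : nat) (F : groupType) (Q : finGroupType)
    (phi : F -> Q) :=
  {morph phi : x y / x * y} /\ p.-group [set: Q]%SET.

Section Nakayama.
Context (F : groupType) (p : nat).
Hypothesis p_pr : prime p.
Implicit Types (s : seq (F * nat)).

Lemma trivial_pquotient : is_pquotient p (fun _ : F => 1 : 'I_1).
Proof. by split=> [u v|]; rewrite ?mulg1// /pgroup cardsT card_ord. Qed.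

Lemma pair_pquotient (Q1 Q2 : finGroupType) (phi1 : F -> Q1) (phi2 : F -> Q2) :
  is_pquotient p phi1 -> is_pquotient p phi2 ->
  is_pquotient p (fun u => (phi1 u, phi2 u)).
Proof.
move=> [M1 p1] [M2 p2]; split=> [u v|]; first by rewrite M1 M2.
by move: p1 p2; rewrite /pgroup !cardsT card_prod pnatM => -> ->.
Qed.

Lemma pquotient_orderP (Q : finGroupType) (phi : F -> Q) (r : F * nat) s :
  is_pquotient p phi -> kills p phi s -> r \in s ->
  exists2 k, (k <= r.2)%N & #[phi r.1] = (p ^ k)%N.
Proof.
move=> [phiM _] phis rs; suff : (#[phi r.1] %| p ^ r.2)%N by move/(dvdn_pfactor _ _ p_pr).
by rewrite order_dvdn -(morph_exp _ phiM); apply/eqP/phis.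
Qed.

(** The order of a root divides the prescribed power of p, so each relator has a quotient maximizing
    it; a product of such quotients maximizes all orders at once. *)
Lemma max_pquotient s :
  exists (Q0 : finGroupType) (phi0 : F -> Q0),
    [/\ is_pquotient p phi0, kills p phi0 s &
      forall (Q : finGroupType) (phi : F -> Q), is_pquotient p phi ->
        kills p phi s -> forall r, r \in s -> (#[phi r.1] %| #[phi0 r.1])%N].
Proof.
have max_r r : r \in s -> exists (Q0 : finGroupType) (phi0 : F -> Q0),
    [/\ is_pquotient p phi0, kills p phi0 s &
      forall (Q : finGroupType) (phi : F -> Q), is_pquotient p phi ->
        kills p phi s -> (#[phi r.1] %| #[phi0 r.1])%N].
  move=> rs; pose P k := `[< exists (Q : finGroupType) (phi : F -> Q),
    [/\ is_pquotient p phi, kills p phi s & #[phi r.1] = (p ^ k)%N] >].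
  have exP : exists k, P k.
    exists 0; apply/asboolP; exists 'I_1, (fun=> 1); split=> //.
      exact: trivial_pquotient.
    by rewrite order1.
  have ubP k : P k -> (k <= r.2)%N.
    move=> /asboolP[Q [phi [pphi phis]]].
    have [j jr ->] := pquotient_orderP pphi phis rs.
    by move/eqP; rewrite eqn_exp2l ?prime_gt1// => /eqP <-.
  case: (ex_maxnP exP ubP) => k /asboolP[Q0 [phi0 [pphi0 phi0s ok]]] kmax.
  exists Q0, phi0; split=> // Q phi pphi phis.
  have [j jr oj] := pquotient_orderP pphi phis rs.
  rewrite ok oj dvdn_exp2l// kmax//; apply/asboolP; by exists Q, phi.
suff : forall s', {subset s' <= s} -> exists (Q0 : finGroupType) (phi0 : F -> Q0),
    [/\ is_pquotient p phi0, kills p phi0 s &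
      forall (Q : finGroupType) (phi : F -> Q), is_pquotient p phi ->
        kills p phi s -> forall r, r \in s' -> (#[phi r.1] %| #[phi0 r.1])%N].
  exact.
elim=> [|r s' IH] ss.
  exists 'I_1, (fun=> 1); split=> //; exact: trivial_pquotient.
have [| Q1 [phi1 [p1 s1 m1]]] := IH; first by move=> x xs; apply/ss/mem_behead.
have [| Q2 [phi2 [p2 s2 m2]]] := max_r r; first exact/ss/mem_head.
exists (Q1 * Q2)%type, (fun u => (phi1 u, phi2 u)); split.
- exact: pair_pquotient.
- by move=> x xs; rewrite s1// s2.
- move=> Q phi pphi phis x; rewrite inE.
  have ex := expg_order (phi1 x.1, phi2 x.1).
  have e1 := congr1 fst ex; have e2 := congr1 snd ex.
  case/predU1P => [xr|xs'].
    rewrite xr in e1 e2 *; apply: dvdn_trans (m2 _ _ pphi phis) _.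
    rewrite order_dvdn; apply/eqP; rewrite -[RHS]e2.
    by elim: #[_] => // n IHn; rewrite !expgS IHn.
  apply: dvdn_trans (m1 _ _ pphi phis _ xs') _.
  rewrite order_dvdn; apply/eqP; rewrite -[RHS]e1.
  by elim: #[_] => // n IHn; rewrite !expgS IHn.
Qed.

(* The normal closure N of the relators in the p-group Q lies in its own
   Frattini subgroup: modulo N the orders are at most those under phi0, so the
   relators that are not kept are p-th powers of elements of N. *)
Lemma nakayama s (Q0 : finGroupType) (phi0 : F -> Q0) :
  is_pquotient p phi0 -> kills p phi0 s ->
  (forall (Q : finGroupType) (phi : F -> Q), is_pquotient p phi ->
        kills p phi s -> forall r, r \in s -> (#[phi r.1] %| #[phi0 r.1])%N) ->
  forall (Q : finGroupType) (phi : F -> Q), is_pquotient p phi ->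
  kills p phi [seq r <- s | #[phi0 r.1] == (p ^ r.2)%N] -> kills p phi s.
Proof.
move=> pphi0 phi0s max0 Q phi [phiM pQ] phis1.
pose A := [set x in [seq phi (relator p r) | r <- s]]%SET.
pose N := <<class_support A [set: Q]>>%G.
have nN x : x \in 'N(N).
  have /fintype.subsetP : ([set: Q] \subset 'N(N))%SET by rewrite norms_gen ?class_support_norm.
  by apply; rewrite finset.in_setT.
have AN r : r \in s -> phi (relator p r) \in N.
  move=> rs; apply/mem_gen/imset2P; exists (phi (relator p r)) 1; rewrite ?inE//.
    exact: map_f.
  by rewrite conjg1.
pose psi u : coset_of N := coset N (phi u).
have psiM : {morph psi : u v / u * v} by move=> u v; rewrite /psi phiM morphM.
have ppsi : is_pquotient p psi.
  split=> //; apply: pgroup_p_elt => xbar _.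
  have [x _ ->] := cosetP xbar.
  by apply: morph_p_elt; rewrite ?nN// (mem_p_elt pQ)// inE.
have psis : kills p psi s.
  by move=> r rs; rewrite /psi coset_id// AN.
have pN : p.-group N by apply: pgroupS pQ; exact: finset.subsetT.
have pPhi x : x \in N -> x ^+ p \in 'Phi(N).
  move=> xN; rewrite (Phi_joing pN) mem_gen// inE; apply/orP; right.
  by have := Mho_p_elt 1 xN (mem_p_elt pN xN); rewrite expn1.
have sNPhi : N \subset 'Phi(N).
  rewrite gen_subG; apply/fintype.subsetP => x /imset2P[y z yA _ ->].
  move: yA; rewrite inE => /mapP[r rs ->] {x y}; rewrite memJ_norm; last first.
    by rewrite -cycle_subG (char_norm_trans (Phi_char N))// cycle_subG nN.
  have [k kr ok] := pquotient_orderP pphi0 phi0s rs.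
  have [kr'|kr'] := eqVneq k r.2.
    by rewrite phis1 ?group1// mem_filter rs ok kr' eqxx.
  have {kr kr'} kr : (k < r.2)%N by rewrite ltn_neqAle kr' kr.
  have psik : psi r.1 ^+ (p ^ r.2.-1) = 1.
    apply/eqP; rewrite -order_dvdn.
    apply: dvdn_trans (max0 _ _ ppsi psis r rs) _.
    by rewrite ok dvdn_exp2l//; lia.
  rewrite /relator -(prednK (leq_ltn_trans (leq0n _) kr)) expnSr expgM.
  rewrite (morph_exp _ phiM); apply: pPhi; rewrite -[_ \in _]/(_ \in gval N).
  by apply: coset_idr => //; rewrite -[LHS]/(psi _) (morph_exp _ psiM).
have N1 : N :=: 1%g.
  apply/eqP; apply: contraT => /Phi_proper; rewrite properE => /andP[_].
  by rewrite sNPhi.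
by move=> r rs; apply/set1gP; rewrite -N1 AN.
Qed.

End Nakayama.

(** * Skew products and cocycles *)

Section Skew.
Local Open Scope ring_scope.
Context {X : choiceType} {T : choiceType} (step : T -> X * bool -> T).
Hypothesis stepK : forall t a, step (step t a) (letter_inv a) = t.
Context {K : zmodType} (d : T -> X -> K).
Implicit Types (t : T) (k : K) (w : seq (X * bool)) (u : freeGroup X).

(** An edge is named by its origin and a positive generator, so that a letter and its inverse
    traverse the same edge in opposite directions. *)
Definition edge t (a : X * bool) : T * X := (if a.2 then t else step t a, a.1).

Definition cocycle t a : K :=
  let e := edge t a in if a.2 then d e.1 e.2 else - d e.1 e.2.

Lemma edge_inv t a : edge (step t a) (letter_inv a) = edge t a.
Proof. by rewrite /edge; case: a => x [] /=; rewrite // stepK. Qed.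

Lemma cocycle_inv t a : cocycle (step t a) (letter_inv a) = - cocycle t a.
Proof. by rewrite /cocycle edge_inv; case: a => x [] //=; rewrite opprK. Qed.

Definition skew (tk : T * K) a : T * K := (step tk.1 a, tk.2 + cocycle tk.1 a).

Lemma skewK tk a : skew (skew tk a) (letter_inv a) = tk.
Proof. by case: tk => t k; rewrite /skew /= stepK cocycle_inv addrK. Qed.

Fixpoint wsum t w : K := if w is a :: w' then cocycle t a + wsum (step t a) w' else 0.

Lemma wact_skew t k w : wact skew (t, k) w = (wact step t w, k + wsum t w).
Proof.
by elim: w t k => [|a w IH] t k /=; rewrite ?addr0// IH addrA.
Qed.

Lemma wsum_cat t w1 w2 : wsum t (w1 ++ w2) = wsum t w1 + wsum (wact step t w1) w2.
Proof. by elim: w1 t => [|a w1 IH] t /=; rewrite ?add0r// IH addrA. Qed.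

Lemma wsumM t u v : wsum t (u * v)%g = wsum t u + wsum (wact step t u) v.
Proof.
have := wactM skewK (t, 0) u v; rewrite !wact_skew => -[_].
by rewrite !add0r.
Qed.

Lemma wsum_reduce t w : wsum t (reduce w) = wsum t w.
Proof.
by have := wact_reduce (t, 0) w skewK; rewrite !wact_skew => -[_]; rewrite !add0r.
Qed.

Lemma wsum_exp t u n :
  wact step t u = t -> wsum t (u ^+ n)%g = wsum t u *+ n.
Proof.
move=> tu; elim: n => [|n IH]; first by rewrite mulr0n.
by rewrite expgS wsumM tu IH mulrS.
Qed.

(** Prefixing and appending [u] give the same power; cancelling the contribution of [u] shows that
    the sum is constant along the cycle of [t] under [u]. Hence one linear equation per cycle will
    suffice. *)
Lemma wsum_rot t u n : wact step t (u ^+ n)%g = t ->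
  wsum (wact step t u) (u ^+ n)%g = wsum t (u ^+ n)%g.
Proof.
move=> tun; apply: (addrI (wsum t u)).
by rewrite -wsumM -expgS expgSr wsumM tun addrC.
Qed.

Lemma skew_exp_fix u m e : (forall t, wact step t (u ^+ m)%g = t) ->
  (forall k, k *+ e = 0) -> forall tk, wact skew tk (u ^+ (m * e))%g = tk.
Proof.
move=> um Ke [t k]; rewrite wact_skew expgnA wsum_exp// Ke addr0.
by rewrite wact_fixX.
Qed.

Lemma wact_word_inv t w : wact step (wact step t w) (word_inv w) = t.
Proof.
elim: w t => [//|a w IH] t; rewrite /word_inv map_cons rev_cons -cats1 wact_cat.
by rewrite -/(word_inv w) /= IH stepK.
Qed.

Lemma wsum_word_inv t w : wsum (wact step t w) (word_inv w) = - wsum t w.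
Proof.
elim: w t => [|a w IH] t; first by rewrite oppr0.
rewrite /word_inv map_cons rev_cons -cats1 wsum_cat -/(word_inv w).
by rewrite /= IH wact_word_inv cocycle_inv addr0 -opprD addrC.
Qed.

Context (E : pred (T * X)).

Fixpoint avoids t w : bool :=
  if w is a :: w' then ~~ E (edge t a) && avoids (step t a) w' else true.

Lemma avoids_cat t w1 w2 :
  avoids t (w1 ++ w2) = avoids t w1 && avoids (wact step t w1) w2.
Proof. by elim: w1 t => [|a w1 IH] t //=; rewrite IH andbA. Qed.

Lemma avoids_word_inv t w : avoids (wact step t w) (word_inv w) = avoids t w.
Proof.
elim: w t => [//|a w IH] t.
rewrite /word_inv map_cons rev_cons -cats1 avoids_cat -/(word_inv w).
by rewrite /= IH wact_word_inv edge_inv andbT andbC.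
Qed.

(** The potential at [t] is the sum along a path to [t] from a representative of its component in
    the graph without the edges of [E]; it is path-independent because loops have sum zero. *)
Lemma coboundary_of_loops (t0 : T) :
  (forall t w, avoids t w -> wact step t w = t -> wsum t w = 0) ->
  exists h : T -> K, forall t x, ~~ E (t, x) -> d t x = h (step t (x, true)) - h t.
Proof.
move=> loops0; pose S t := [set r | exists w, avoids r w /\ wact step r w = t].
have SE t a : ~~ E (edge t a) -> S t `<=` S (step t a).
  move=> Eta r [w [rw rwt]]; exists (w ++ [:: a]).
  by rewrite avoids_cat wact_cat rw rwt /= Eta.
(* [xget] depends only on the set [S t], so the vertices of one component get the same
   representative; the default [t0] is harmless since [S t] contains [t]. *)
pose rep t := xget t0 (S t).
have repP t : S t (rep t) by apply: (xgetI t0 (x := t)); exists [::].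
have [path pathP] : {path : T -> seq (X * bool) &
    forall t, avoids (rep t) (path t) /\ wact step (rep t) (path t) = t}.
  exact: (choice repP).
exists (fun t => wsum (rep t) (path t)) => t x Etx; set t' := step _ _.
have rr : rep t' = rep t.
  rewrite /rep; congr xget; apply/seteqP; split; last exact: SE.
  have -> : t = step t' (letter_inv (x, true)) by rewrite stepK.
  by apply: SE; rewrite edge_inv.
have [at_ pt] := pathP t; have [at'] := pathP t'; rewrite rr => pt'.
rewrite rr in at'.
have av' := avoids_word_inv (rep t) (path t').
have wa' := wact_word_inv (rep t) (path t').
have ws' := wsum_word_inv (rep t) (path t').
rewrite pt' in av' wa' ws'.
(* The loop runs out along [path t], across the edge and back along [path t']. *)
have := loops0 (rep t) (path t ++ (x, true) :: word_inv (path t')).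
rewrite avoids_cat wact_cat wsum_cat at_ pt /= -/t' Etx av' wa' ws' at'.
rewrite /cocycle /= => /(_ isT erefl)/eqP.
by rewrite addrA subr_eq0 => /eqP <-; rewrite addrAC subrr add0r.
Qed.

End Skew.

(** * Linear algebra *)

Section CountingCocycles.
Context {X T : finType} (step : T -> X * bool -> T).
Hypothesis stepK : forall t a, step (step t a) (letter_inv a) = t.

Definition has_exact_period (u : freeGroup X) (m : nat) :=
  [/\ (0 < m)%N, forall t, wact step t (u ^+ m) = t &
      forall t i, (0 < i < m)%N -> wact step t (u ^+ i) <> t].

(** All cycles of [u] have length [m], so they partition [T] uniformly. *)
Lemma orbit_representatives (u : freeGroup X) (m : nat) :
  has_exact_period u m ->
  exists reps : seq T, (size reps * m)%N = #|T| /\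
    forall t, exists r i, r \in reps /\ t = wact step r (u ^+ i).
Proof.
move=> [m_gt0 um u_min]; pose s := wperm stepK u.
have sE i t : (s ^+ i) t = wact step t (u ^+ i).
  by rewrite -(morph_exp _ (wpermM stepK)) wpermE.
have card_s t : #|porbit s t| = m.
  apply/eqP; rewrite eqn_leq; apply/andP; split.
    (* In a longer cycle [t] would reappear at position [m] of its duplicate-free trajectory. *)
    rewrite leqNgt; apply/negP => m_lt; have := uniq_traject_porbit s t.
    rewrite -(subnKC m_lt) addSn -addnS trajectD cat_uniq => /and3P[_ /hasPn].
    move=> /(_ t); rewrite /= -permX sE um inE eqxx => /(_ isT).
    by rewrite -(prednK m_gt0) /= inE eqxx.
  rewrite leqNgt; apply/negP => lt_m; apply: (u_min t #|porbit s t|).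
    by rewrite lt_m lt0n card_porbit_neq0.
  by rewrite -sE permX iter_porbit.
have Ppart : finset.partition (porbits s) [set: T]%SET.
  apply/and3P; split.
  - apply/eqP/setP => t; rewrite !inE; apply/finset.bigcupP.
    by exists (porbit s t); [exact: imset_f | exact: porbit_id].
  - apply/finset.trivIsetP => _ _ /imsetP[t _ ->] /imsetP[t' _ ->]; apply: contraNT.
    move=> /pred0Pn[x /andP[/= xt xt']]; apply/eqP.
    transitivity (porbit s x); apply/eqP; last by rewrite eq_porbit_mem.
    by rewrite eq_sym eq_porbit_mem.
  - by apply/negP => /imsetP[t _ /setP/(_ t)]; rewrite porbit_id inE.
have [t0|T0] := pickP (mem T); last first.
  exists [::]; split=> [|t]; last by have := T0 t.
  by apply/esym/eqP/pred0P.
exists [seq odflt t0 [pick t in B : {set T}] | B <- enum (porbits s)]; split.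
  rewrite size_map -cardE -cardsT (card_uniform_partition (n := m) _ Ppart)// => B.
  by move=> /imsetP[t _ ->].
move=> t; set r := odflt t0 [pick r in porbit s t].
have /porbitP[k tk] : t \in porbit s r.
  rewrite porbit_sym /r; case: pickP => // /(_ t).
  by rewrite /= porbit_id.
exists r, k; split; last by rewrite -sE.
by apply: (map_f (fun B : {set T} => odflt t0 [pick t in B])); rewrite mem_enum imset_f.
Qed.
End CountingCocycles.

Section LinearAlgebra.
Local Open Scope ring_scope.
Lemma dim_cap_lker (K : fieldType) (V : vectType K) (fs : seq 'Hom(V, K^o)) :
  (\dim {:V} <= \dim (\bigcap_(f <- fs) lker f)%VS + size fs)%N.
Proof.
elim: fs => [|f fs IH]; first by rewrite big_nil addn0.
apply: leq_trans IH _; rewrite big_cons capvC /= addnS -addSn leq_add2r.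
rewrite -(limg_ker_dim f (\bigcap_(f <- fs) lker f)%VS) -addn1 leq_add2l.
by apply: leq_trans (dimvS (subvf _)) _; rewrite dimvf.
Qed.

(** Each functional lowers the dimension by at most one, so the common kernel is too large to lie in
    an image of [W]. *)
Lemma exists_in_kernels_notin_image (K : fieldType) (V W : vectType K)
    (fs : seq 'Hom(V, K^o)) (g : 'Hom(W, V)) :
  (size fs + \dim {:W} < \dim {:V})%N ->
  exists2 v : V, (forall f, f \in fs -> f v = 0) & v \notin limg g.
Proof.
move=> lt_dim; pose U := (\bigcap_(f <- fs) lker f)%VS.
have /subvPn[v vU vg] : ~~ (U <= limg g)%VS.
  apply: contraL lt_dim => /dimvS UW; rewrite -leqNgt.
  apply: leq_trans (dim_cap_lker fs) _; rewrite addnC leq_add2l.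
  apply: leq_trans UW _.
  by rewrite -[X in (_ <= X)%N](limg_ker_dim g) leq_addl.
exists v => // f; move: vU; rewrite /U; elim: fs {U lt_dim} => // f' fs IH.
rewrite big_cons memv_cap memv_ker => /andP[/eqP f'v /IH {}IH].
by rewrite inE => /predU1P[->|].
Qed.

Lemma dim_ffun_field (K : fieldType) (I : finType) :
  \dim {:{ffun I -> K^o}} = #|I|.
Proof. by rewrite dimvf /dim /= muln1. Qed.
End LinearAlgebra.

(** * Cocycles from a dimension count *)

Section ExistsCocycle.
Local Open Scope ring_scope.
Context {X T : finType} (step : T -> X * bool -> T).
Hypothesis stepK : forall t a, step (step t a) (letter_inv a) = t.
Context (K : fieldType) (E : pred (T * X)).

Local Notation V := {ffun T * X -> K^o}.
Local Notation W := {ffun T -> K^o}.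

Definition ffun_cocycle (v : V) t x : K := v (t, x).

Definition eval_edge e (v : V) : K^o := v e.

Fact eval_edge_linear e : linear (eval_edge e).
Proof. by move=> k u v; rewrite /eval_edge !ffunE. Qed.
HB.instance Definition _ e := GRing.isLinear.Build K V K^o _ _ (eval_edge_linear e).

Definition eval_word t w (v : V) : K^o := wsum step (ffun_cocycle v) t w.

Fact eval_word_linear t w : linear (eval_word t w).
Proof.
move=> k u v; rewrite /eval_word; elim: w t => [|a w IH] t /=.
  by rewrite scaler0 addr0.
rewrite IH scalerDr addrACA; congr (_ + _); rewrite /cocycle /ffun_cocycle.
by case: a.2; rewrite !ffunE// opprD scalerN.
Qed.
HB.instance Definition _ t w :=
  GRing.isLinear.Build K V K^o _ _ (eval_word_linear t w).

(** Set to zero on [E]: a function vanishing on [E] has this form exactly when it is a coboundary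
    off [E]. *)
Definition coboundary (h : W) : V :=
  [ffun e => if E e then 0 else h (step e.1 (e.2, true)) - h e.1].

Fact coboundary_linear : linear coboundary.
Proof.
move=> k u v; apply/ffunP => e; rewrite !ffunE; case: ifP => _.
  by rewrite scaler0 addr0.
by rewrite scalerBr opprD addrACA.
Qed.
HB.instance Definition _ := GRing.isLinear.Build K W V _ _ coboundary_linear.

(** The unknowns are the values on the #|T| * #|X| edges. There is one equation for each edge of [E]
    and one for each cycle of a root, and the coboundaries have dimension at most #|T|; the strict
    inequality leaves a solution outside them. *)
Lemma exists_cocycle (s : seq (freeGroup X * nat)) :
  (forall r, r \in s -> has_exact_period step r.1 r.2) ->
  (#|E| + \sum_(r <- s) #|T| %/ r.2 + #|T| < #|T| * #|X|)%N ->
  exists d : T -> X -> K,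
    [/\ forall e, E e -> d e.1 e.2 = 0,
        forall r t, r \in s -> wsum step d t (r.1 ^+ r.2)%g = 0 &
        ~ exists h : T -> K,
          forall t x, ~~ E (t, x) -> d t x = h (step t (x, true)) - h t].
Proof.
move=> s_per lt_dim.
have ex_reps r : exists reps : seq T, r \in s ->
    (size reps * r.2)%N = #|T| /\
    forall t, exists t0 i, t0 \in reps /\ t = wact step t0 (r.1 ^+ i)%g.
  case: (boolP (r \in s)) => [rs|_]; last by exists [::].
  by have [reps] := orbit_representatives stepK (s_per _ rs); exists reps.
have [reps_of repsP] := choice ex_reps.
pose fE := [seq linfun (eval_edge e) | e <- enum E].
pose fr (r : freeGroup X * nat) := [seq linfun (eval_word t (r.1 ^+ r.2)%g) | t <- reps_of r].
pose fs := fE ++ flatten [seq fr r | r <- s].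
have [] := @exists_in_kernels_notin_image K V W fs (linfun coboundary).
  rewrite !dim_ffun_field card_prod; apply: leq_ltn_trans lt_dim.
  rewrite leq_add2r size_cat size_map -cardE leq_add2l size_flatten /shape.
  rewrite -map_comp sumnE big_map big_seq [leqRHS]big_seq; apply: leq_sum => r rs.
  have [r_gt0 _ _] := s_per _ rs; have [<- _] := repsP _ rs.
  by rewrite mulnK//= size_map.
move=> v v0 v_cob; exists (ffun_cocycle v).
have vE e : E e -> v e = 0.
  move=> Ee; have := v0 (linfun (eval_edge e)); rewrite lfunE; apply.
  rewrite mem_cat (map_f (fun e => linfun (eval_edge e)))// mem_enum.
  exact: Ee.
split=> [[t x] /vE//|r t rs|[h hE]].
  have [_ /(_ t)[t0 [i [t0r ->]]]] := repsP _ rs.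
  have [_ per _] := s_per _ rs.
  have : wsum step (ffun_cocycle v) t0 (r.1 ^+ r.2)%g = 0.
    have := v0 (linfun (eval_word t0 (r.1 ^+ r.2)%g)); rewrite lfunE; apply.
    rewrite mem_cat; apply/orP; right; apply/flattenP; exists (fr r).
      exact: map_f.
    exact: (map_f (fun t => linfun (eval_word t (r.1 ^+ r.2)%g))).
  move=> <-; elim: i => [//|i IH]; rewrite -IH expgSr (wactM stepK).
  by rewrite (wsum_rot stepK).
move/negP: v_cob; apply.
have -> : v = linfun coboundary [ffun t => h t].
  apply/ffunP => -[t x]; rewrite lfunE /= ffunE /= !ffunE.
  by case: ifPn => [/vE//|/hE].
exact: memv_img (memvf _).
Qed.

End ExistsCocycle.

(** * Labelled actions *)

Section Labelled.
Context {X : choiceType} {T : Type} (step : T -> X * bool -> T).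
Hypothesis stepK : forall t a, step (step t a) (letter_inv a) = t.
Context {A : groupType} (lab : T -> X * bool -> A).
Hypothesis labV : forall t a, lab (step t a) (letter_inv a) = (lab t a)^-1.
Implicit Types (t : T) (b : A) (w : seq (X * bool)) (u v : freeGroup X).

Definition lstep (tb : T * A) a : T * A := (step tb.1 a, tb.2 * lab tb.1 a).

Lemma lstepK tb a : lstep (lstep tb a) (letter_inv a) = tb.
Proof. by case: tb => t b; rewrite /lstep /= stepK labV mulgK. Qed.

Definition wlab t w : A := (wact lstep (t, 1) w).2.

Lemma wact_lstep t b w : wact lstep (t, b) w = (wact step t w, b * wlab t w).
Proof.
rewrite /wlab; elim: w t b => [|a w IH] t b /=; first by rewrite mulg1.
by rewrite IH [in RHS]IH /= mul1g mulgA.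
Qed.

Lemma wlab_cons t a w : wlab t (a :: w) = lab t a * wlab (step t a) w.
Proof. by rewrite {1}/wlab /= /lstep /= mul1g wact_lstep. Qed.

Lemma wlabM t u v : wlab t (u * v) = wlab t u * wlab (wact step t u) v.
Proof. by rewrite {1}/wlab (wactM lstepK) !wact_lstep /= mul1g. Qed.

Lemma wlabV t u : wlab (wact step t u) (u^-1 : freeGroup X) = (wlab t u)^-1.
Proof. by apply/esym/mulg1_eq; rewrite -wlabM mulgV. Qed.

Lemma wlab_reduce t w : wlab t (reduce w) = wlab t w.
Proof. by rewrite /wlab (wact_reduce _ _ lstepK). Qed.

Lemma wlab_exp t u n : wact step t u = t -> wlab t (u ^+ n) = wlab t u ^+ n.
Proof.
by move=> tu; elim: n => [//|n IH]; rewrite !expgS wlabM tu IH.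
Qed.

Definition unlabelled_path t t' := exists u, wact step t u = t' /\ wlab t u = 1.

Lemma unlabelled_path_refl t : unlabelled_path t t.
Proof. by exists 1. Qed.

Lemma unlabelled_path_sym t t' : unlabelled_path t t' -> unlabelled_path t' t.
Proof.
by move=> [u [<- u1]]; exists u^-1; rewrite (wactK stepK) wlabV u1 invg1.
Qed.

Lemma unlabelled_path_trans t' t t'' :
  unlabelled_path t t' -> unlabelled_path t' t'' -> unlabelled_path t t''.
Proof.
move=> [u [<- u1]] [v [<- v1]]; exists (u * v).
by rewrite (wactM stepK) wlabM u1 v1 mulg1.
Qed.

End Labelled.

(* The labels are the coboundary of g on the edges starting in E and trivial
   elsewhere. *)
Section PotentialLabels.
Context {X : choiceType} {T : choiceType} (step : T -> X * bool -> T).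
Hypothesis stepK : forall t a, step (step t a) (letter_inv a) = t.
Context {A : groupType} (g : T -> A) (E : pred T).

Definition potential_label t (a : X * bool) : A :=
  if E (edge step t a).1 then (g t)^-1 * g (step t a) else 1.

Lemma potential_labelV t a :
  potential_label (step t a) (letter_inv a) = (potential_label t a)^-1.
Proof.
rewrite /potential_label (edge_inv stepK) stepK.
by case: ifP => _; rewrite ?invg1// invMg invgK.
Qed.

Lemma wlab_avoids t w :
  avoids step (fun e => E e.1) t w -> wlab step potential_label t w = 1.
Proof.
elim: w t => [//|a w IH] t /= /andP[Ea /IH {}IH].
by rewrite wlab_cons IH /potential_label (negPf Ea) mulg1.
Qed.

End PotentialLabels.

(** All elements act with p-power order, so the image in the permutation group is a finite
    p-quotient, to which the hypothesis on [s1] and [s] applies. *)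
Lemma action_killed (X : choiceType) (T : finType) (step : T -> X * bool -> T)
    (p : nat) (s1 s : seq (freeGroup X * nat)) :
  prime p ->
  (forall t a, step (step t a) (letter_inv a) = t) ->
  (forall u : freeGroup X, exists e, forall t, wact step t (u ^+ (p ^ e)) = t) ->
  (forall (Q : finGroupType) (phi : freeGroup X -> Q), is_pquotient p phi ->
    kills p phi s1 -> kills p phi s) ->
  (forall r t, r \in s1 -> wact step t (relator p r) = t) ->
  forall r t, r \in s -> wact step t (relator p r) = t.
Proof.
move=> p_pr stepK p_exp nak s1T r t rs; pose phi := wperm stepK.
have phiM : {morph phi : u v / u * v} := wpermM stepK.
have [|Q [phi' [phi'M pQ _ _ phi'1]]] := @corestriction _ _ phi p phiM.
  move=> u; have [e ue] := p_exp u; apply: (@pnat_dvd _ (p ^ e)).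
    rewrite order_dvdn -(morph_exp _ phiM); apply/eqP.
    by apply/(wperm1P stepK) => t'; exact: ue.
  by rewrite pnatX pnat_id.
have /phi'1/(wperm1P stepK)// : phi' (relator p r) = 1.
apply: (nak Q phi') => // x xs; apply/phi'1/(wperm1P stepK) => t'.
exact: s1T.
Qed.

(** * An integral cocycle with a loop of value one *)

Section SumMorph.
Local Open Scope ring_scope.
Context {X : choiceType} {T : choiceType} (step : T -> X * bool -> T).

Lemma wsum_additive (K K' : zmodType) (f : {additive K -> K'}) (d : T -> X -> K) t w :
  wsum step (fun t x => f (d t x)) t w = f (wsum step d t w).
Proof.
elim: w t => [|a w IH] t /=; first by rewrite raddf0.
by rewrite IH raddfD /cocycle; case: a.2; rewrite ?raddfN.
Qed.

Lemma eq_wsum (K : zmodType) (d d' : T -> X -> K) t w :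
  (forall t x, d t x = d' t x) -> wsum step d t w = wsum step d' t w.
Proof.
move=> dd'; elim: w t => [//|a w IH] t /=.
by rewrite IH /cocycle; case: a.2; rewrite dd'.
Qed.

Lemma wsum_gauge (K : zmodType) (d : T -> X -> K) (h : T -> K) t w :
  (forall t a, step (step t a) (letter_inv a) = t) ->
  wsum step (fun t x => h t + d t x - h (step t (x, true))) t w =
  h t + wsum step d t w - h (wact step t w).
Proof.
move=> stepK; elim: w t => [|a w IH] t /=; first by rewrite addr0 subrr.
rewrite IH /cocycle /edge; case: a => x [] /=.
  by rewrite -!addrA addKr.
have := stepK t (x, false); rewrite /letter_inv /= => ->.
by rewrite opprB opprD [- h _ - _]addrC -!addrA addKr.
Qed.

End SumMorph.

Lemma intr_Zp_eq0 (n : nat) (z : int) : (1 < n)%N ->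
  (z%:~R == 0 :> 'Z_n)%R = (n %| absz z)%N.
Proof.
move=> n_gt1; have natP m : (m%:R == 0 :> 'Z_n)%R = (n %| m)%N.
  by rewrite -val_eqE /= val_Zp_nat.
case: z => m /=; first exact: natP.
by rewrite NegzE mulrNz oppr_eq0 natP.
Qed.

Lemma Zp_mulrn_self (n : nat) (i : 'Z_n) : (1 < n)%N -> (i *+ n = 0)%R.
Proof.
move=> n_gt1; rewrite -mulr_natr.
have -> : (n%:R = 0 :> 'Z_n)%R; last by rewrite mulr0.
by apply/eqP; rewrite -val_eqE /= val_Zp_nat// modnn.
Qed.

Section IntegralCocycle.
Context {X : finType} (p : nat) (s : seq (freeGroup X * nat)).
Context {Q : finGroupType} (phi : freeGroup X -> Q).
Hypothesis p_pr : prime p.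
Hypothesis phiM : {morph phi : u v / u * v}.
Hypothesis pQ : p.-group [set: Q]%SET.
Hypothesis phi_onto : forall q, exists u, phi u = q.
Hypothesis phi_s : kills p phi s.
Let s1 := [seq r <- s | #[phi r.1] == (p ^ r.2)%N].
Hypothesis nak : forall (Q' : finGroupType) (phi' : freeGroup X -> Q'),
  is_pquotient p phi' -> kills p phi' s1 -> kills p phi' s.
Hypothesis deficiency :
  (\sum_(r <- s1) #|Q| %/ p ^ r.2 + #|Q| < #|Q| * #|X|)%N.

(** The Cayley graph of [Q]; its loops are the words in the kernel of [phi]. *)
Definition stepQ : Q -> X * bool -> Q := lift_step (fun x => phi (free_gen x)).

Lemma stepQK q a : stepQ (stepQ q a) (letter_inv a) = q.
Proof. exact: lift_stepK. Qed.

Lemma wact_stepQ q (u : freeGroup X) : wact stepQ q u = q * phi u.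
Proof.
rewrite wact_lift_step; congr (_ * _).
apply: (free_morph_ext (free_liftM _) phiM) u => x; exact: free_lift_gen.
Qed.

Lemma stepQ_p_exponent :
  exists k, forall (u : freeGroup X) q, wact stepQ q (u ^+ (p ^ k)) = q.
Proof.
have [k Qk] := p_natP pQ; exists k => u q.
by rewrite wact_stepQ (morph_exp _ phiM) -Qk expg_cardG ?mulg1// inE.
Qed.

Lemma s1_has_exact_period (r : freeGroup X * nat) : r \in s1 ->
  has_exact_period stepQ r.1 (p ^ r.2).
Proof.
rewrite mem_filter => /andP[/eqP ord rs]; split.
- by rewrite expn_gt0 prime_gt0.
- by move=> q; rewrite wact_stepQ (phi_s rs) mulg1.
- move=> q i /andP[i_gt0 i_lt]; rewrite wact_stepQ (morph_exp _ phiM).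
  move=> /(canRL (mulKg _)); rewrite mulVg => /eqP; rewrite -order_dvdn ord.
  by move=> /dvdn_leq -/(_ i_gt0); rewrite leqNgt i_lt.
Qed.

Local Open Scope ring_scope.

(** The dimension count with no forbidden edge; a function that is not a coboundary has a non-zero
    sum along some loop. *)
Lemma rational_cocycle :
  exists d : Q -> X -> rat,
    (forall r q, r \in s1 -> wsum stepQ d q (relator p r) = 0) /\
    exists q u, phi u = 1%g /\ wsum stepQ d q u != 0.
Proof.
pose s1' := [seq (r.1, (p ^ r.2)%N) | r <- s1].
have [] := @exists_cocycle _ _ _ stepQK rat pred0 s1'.
- by move=> _ /mapP[r rs1 ->]; exact: s1_has_exact_period.
- by rewrite card0 add0n big_map.
move=> d [_ d_s1 d_cob]; exists d; split.
  move=> r q rs1; apply: (d_s1 (r.1, (p ^ r.2)%N)).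
  exact: (map_f (fun r => (r.1, (p ^ r.2)%N))).
apply: contrapT => d0; apply: d_cob.
apply: (@coboundary_of_loops _ _ _ stepQK _ d pred0 1%g) => q w _ qw.
apply: contrapT => /eqP dw; apply: d0; exists q, (reduce w).
rewrite (wsum_reduce stepQK); split=> //.
apply: (@mulgI _ q); rewrite -wact_stepQ mulg1.
by rewrite (wact_reduce _ _ stepQK).
Qed.

Lemma integer_cocycle :
  exists c : Q -> X -> int,
    (forall r q, r \in s1 -> wsum stepQ c q (relator p r) = 0) /\
    exists q u, phi u = 1%g /\ wsum stepQ c q u != 0.
Proof.
have [d [d_s1 [q [u [u1 du]]]]] := rational_cocycle.
pose N : int := \prod_(e : Q * X) denq (d e.1 e.2).
have N0 : N != 0 by apply/prodf_neq0 => e _; exact: denq_neq0.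
have cE e : exists z : int, z%:~R = N%:~R * d e.1 e.2.
  exists (numq (d e.1 e.2) * \prod_(e' : Q * X | e' != e) denq (d e'.1 e'.2)).
  rewrite /N [in RHS](bigD1 e)//= !intrM mulrAC; congr (_ * _).
  by rewrite mulrC -{2}[d _ _]divq_num_den mulfVK// intr_eq0 denq_neq0.
have [c0 c0E] := choice cE; pose c q x := c0 (q, x).
have wc q' w : (wsum stepQ c q' w)%:~R = N%:~R * wsum stepQ d q' w :> rat.
  rewrite -(wsum_additive _ (intmul 1 : {additive int -> rat})).
  have := wsum_additive stepQ (N%:~R \*o @idfun rat : {additive rat -> rat}) d q' w.
  by move=> /= <-; apply: eq_wsum => t x; rewrite c0E.
exists c; split.
  by move=> r q' rs; apply/eqP; rewrite -(intr_eq0 rat) wc d_s1// mulr0.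
by exists q, u; split=> //; rewrite -(intr_eq0 rat) wc mulf_neq0 ?intr_eq0.
Qed.

(** The sums along loops at [q0] form a non-zero subgroup of the integers. A change of gauge makes
    every edge value a multiple of its positive generator; after division by it, every vertex has a
    loop of sum one. *)
Lemma normalized_cocycle :
  exists c : Q -> X -> int,
    (forall r q, r \in s1 -> wsum stepQ c q (relator p r) = 0) /\
    forall q, exists u, phi u = 1%g /\ wsum stepQ c q u = 1.
Proof.
have [c0 [c0_s1 [q0 [u0 [u01 c0u0]]]]] := integer_cocycle.
pose val u := wsum stepQ c0 q0 u.
have valM u v : phi u = 1%g -> val (u * v)%g = val u + val v.
  by move=> u1; rewrite /val (wsumM stepQK) wact_stepQ u1 mulg1.
have fix_q0 u : phi u = 1%g -> wact stepQ q0 u = q0.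
  by move=> u1; rewrite wact_stepQ u1 mulg1.
have valV u : phi u = 1%g -> val (u^-1)%g = - val u.
  move=> u1; apply/eqP; rewrite -addr_eq0 addrC -valM// mulgV.
  by rewrite /val /=.
have valX u n : phi u = 1%g -> val (u ^+ n)%g = val u *+ n.
  by move=> u1; rewrite /val (wsum_exp stepQK)// fix_q0.
(* Shifted by one, so that the least [n] gives the least positive loop value n + 1. *)
pose P n := `[< exists u, phi u = 1%g /\ val u = n.+1%:Z >].
have exP : exists n, P n.
  have vu : val u0 != 0 by [].
  exists (absz (val u0)).-1; apply/asboolP; case: (lerP 0 (val u0)) => vu_sgn.
    by exists u0; split=> //; lia.
  exists (u0^-1)%g; rewrite (morph_inv phiM) u01 invg1 valV//; split=> //; lia.
case: (ex_minnP exP) => n /asboolP[t [t1 vt]] nmin {exP}.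
(* Euclidean division: a non-zero remainder would be a smaller positive loop value. *)
have div_n u : phi u = 1%g -> (n.+1%:Z %| val u)%Z.
  move=> u1; apply/dvdz_mod0P; apply: contrapT => /eqP m0.
  have r_ge0 : (0 <= val u %% n.+1%:Z)%Z by exact: modz_ge0.
  have r_lt : (val u %% n.+1%:Z < n.+1%:Z)%Z by exact: ltz_pmod.
  have tq1 : phi (t ^+ `|(val u %/ n.+1%:Z)%Z|)%g = 1%g.
    by rewrite (morph_exp _ phiM) t1 expg1n.
  have [v [v1 vv]] : exists v, phi v = 1%g /\ val v = (val u %% n.+1%:Z)%Z.
    case: (lerP 0 (val u %/ n.+1%:Z)%Z) => [q_ge0|q_lt0].
      exists (u * (t ^+ `|(val u %/ n.+1%:Z)%Z|)^-1)%g; split.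
        by rewrite phiM u1 (morph_inv phiM) tq1 invg1 mulg1.
      by rewrite valM// valV// valX// vt; lia.
    exists (u * (t ^+ `|(val u %/ n.+1%:Z)%Z|))%g; split.
      by rewrite phiM u1 tq1 mulg1.
    by rewrite valM// valX// vt; lia.
  have : P (absz (val v)).-1 by apply/asboolP; exists v; split=> //; lia.
  by move=> /nmin; lia.
have sigma_ex q : exists u, (q0 * phi u)%g = q.
  by have [u uE] := phi_onto (q0^-1 * q)%g; exists u; rewrite uE mulVKg.
have [sigma sigmaE] := choice sigma_ex.
pose h q := val (sigma q).
(* In this gauge an edge value is the sum around a loop at [q0]: out along [sigma q], across the
   edge, back along [sigma] of its end. Hence it is divisible by n + 1. *)
pose c1 q x := h q + c0 q x - h (stepQ q (x, true)).
have c1_div q x : exists z : int, z * n.+1%:Z = c1 q x.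
  have : (n.+1%:Z %| c1 q x)%Z.
    suff -> : c1 q x = val (sigma q * free_gen x *
        (sigma (stepQ q (x, true)))^-1)%g.
      apply: div_n; rewrite !phiM (morph_inv phiM); apply: (@mulgI _ q0).
      rewrite !mulgA sigmaE mulg1 -[(q * _)%g]/(stepQ q (x, true)).
      by rewrite -{1}(sigmaE (stepQ q (x, true))) mulgK.
    rewrite /val !(wsumM stepQK) (wactM stepQK) !wact_stepQ sigmaE.
    rewrite -[(q * _)%g]/(stepQ q (x, true)).
    set q' := stepQ q (x, true).
    have := wsumM stepQK c0 q0 (sigma q') ((sigma q')^-1)%g.
    rewrite mulgV wact_stepQ sigmaE /= => /esym/eqP; rewrite addrC addr_eq0.
    by move/eqP => ->; rewrite /c1 /= addr0.
  by move=> /dvdzP[z ->]; exists z.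
have [c' c'E] := choice (fun e : Q * X => c1_div e.1 e.2).
exists (fun q x => c' (q, x)).
have wc q w : wsum stepQ (fun q x => c' (q, x)) q w * n.+1%:Z =
    h q + wsum stepQ c0 q w - h (wact stepQ q w).
  rewrite -(wsum_gauge _ _ _ _ stepQK).
  have := wsum_additive stepQ (n.+1%:Z \*o @idfun int : {additive int -> int})
    (fun q x => c' (q, x)) q w.
  rewrite /= mulrC => <-; apply: eq_wsum => q' x.
  by rewrite mulrC; exact: (c'E (q', x)).
split.
  move=> r q rs; have := wc q (relator p r).
  have rs' : r \in s by move: rs; rewrite mem_filter => /andP[].
  rewrite c0_s1// wact_stepQ phi_s// mulg1 addr0 subrr => /eqP.
  by rewrite mulf_eq0 orbF => /eqP.
(* Conjugation by [sigma q] moves the loop [t] from [q0] to [q]. *)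
move=> q; exists (t ^ sigma q)%g; split.
  by rewrite /conjg !phiM t1 mul1g -phiM mulVg (morph1_id phiM).
have qV : wact stepQ q ((sigma q)^-1)%g = q0.
  by rewrite -{1}(sigmaE q) -wact_stepQ (wactK stepQK).
have wt : wsum stepQ c0 q (t ^ sigma q)%g = n.+1%:Z.
  rewrite /conjg (wsumM stepQK) qV (wsumM stepQK) fix_q0//.
  have := wsumM stepQK c0 q ((sigma q)^-1)%g (sigma q).
  rewrite mulVg qV addrCA => <-.
  by rewrite addr0 -[wsum _ _ _ _]/(val t) vt.
have := wc q (t ^ sigma q)%g; rewrite wt wact_stepQ.
have -> : phi (t ^ sigma q)%g = 1%g.
  by rewrite /conjg !phiM t1 mul1g -phiM mulVg (morph1_id phiM).
rewrite mulg1 [h q + _]addrC addrK => /eqP.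
by rewrite -subr_eq0 -{2}[n.+1%:Z]mul1r -mulrBl mulf_eq0 orbF subr_eq0 => /eqP.
Qed.

(** Modulo a power [n] of p exceeding |z|, the skew product is a finite action of p-power exponent
    on which the kept relators act trivially; by [nak] so do all relators. Thus [n] divides [z],
    which forces z = 0. *)
Lemma cocycle_kills_all (c : Q -> X -> int) :
  (forall r q, r \in s1 -> wsum stepQ c q (relator p r) = 0) ->
  forall r q, r \in s -> wsum stepQ c q (relator p r) = 0.
Proof.
move=> c_s1 r q rs; set z := wsum _ _ _ _.
pose n := (p ^ (absz z).+1)%N.
have n_gt : (absz z < n)%N.
  by apply: leq_trans (ltn_expl (absz z).+1 (prime_gt1 p_pr)).
have n_gt1 : (1 < n)%N by rewrite -(exp1n (absz z).+1) ltn_exp2r// prime_gt1.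
pose d q x : 'Z_n := (c q x)%:~R.
have wd q' w : wsum stepQ d q' w = (wsum stepQ c q' w)%:~R.
  exact: (wsum_additive _ (intmul 1 : {additive int -> 'Z_n})).
have : wact (skew stepQ d) (q, 0) (relator p r) = (q, 0).
  apply: (action_killed p_pr _ _ nak) => //.
  - by move=> t a; rewrite (skewK stepQK).
  - have [k Qk] := stepQ_p_exponent => u.
    exists (k + (absz z).+1)%N => tk; rewrite expnD.
    apply: (skew_exp_fix stepQK) => //.
    by move=> i; exact: Zp_mulrn_self.
  - move=> r' [q' i] rs1; rewrite wact_skew wd c_s1// addr0 wact_stepQ.
    by move: rs1; rewrite mem_filter => /andP[_ /phi_s ->]; rewrite mulg1.
rewrite wact_skew add0r wd => -[_ /eqP]; rewrite intr_Zp_eq0// -/z => dvd_z.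
apply/eqP; rewrite -absz_eq0; apply: contraLR n_gt; rewrite -lt0n -leqNgt.
by move=> z_gt0; exact: dvdn_leq.
Qed.

End IntegralCocycle.

(** * The Baumslag-Pride labelling *)

Section CyclicCover.
Local Open Scope ring_scope.
Context {X T : finType} (step : T -> X * bool -> T).
Hypothesis stepK : forall t a, step (step t a) (letter_inv a) = t.
Context (c : T -> X -> int) (C W n : nat).
Hypothesis c_le : forall t x, (absz (c t x) <= C)%N.
Hypothesis C_le_W : (C <= W)%N.
Hypothesis W_lt_n : (W.*2.+1 < n)%N.

Lemma cover_n_gt1 : (1 < n)%N.
Proof. by apply: leq_ltn_trans W_lt_n; rewrite ltnS. Qed.
Local Notation n_gt1 := cover_n_gt1.

Definition cmod (t : T) (x : X) : 'Z_n := (c t x)%:~R.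
(** The cyclic cover of degree [n], whose second coordinate is the level. [C] bounds the change of
    level along an edge, and [W] is the half-width of a window around level 0. *)
Definition cover_step : T * 'Z_n -> X * bool -> T * 'Z_n := skew step cmod.

Lemma cover_stepK t a : cover_step (cover_step t a) (letter_inv a) = t.
Proof. exact: skewK. Qed.

Lemma cocycle_cmod t a : cocycle step cmod t a = (cocycle step c t a)%:~R.
Proof. by rewrite /cocycle; case: a.2; rewrite // mulrNz. Qed.

Lemma wsum_cmod t w : wsum step cmod t w = (wsum step c t w)%:~R.
Proof. exact: (wsum_additive _ (intmul 1 : {additive int -> 'Z_n})). Qed.

Lemma absz_cocycle t a : (absz (cocycle step c t a) <= C)%N.
Proof. by rewrite /cocycle; case: a.2; rewrite ?abszN c_le. Qed.

(** Since n > 2W + 1, a negative level in the window has its representative above [W]. *)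
Lemma val_intr (l : int) : (absz l <= W)%N ->
  ((l%:~R : 'Z_n) <= W)%N = (0 <= l).
Proof.
move=> lW; have n1 := n_gt1; case: (lerP 0 l) => l_sgn.
  have -> : l = (absz l)%:Z by lia.
  by rewrite /= -[_%:~R]/(_%:R) val_Zp_nat// modn_small//; lia.
have -> : (l%:~R : 'Z_n) = (n - absz l)%:R.
  have lE : l = (n - absz l)%N%:Z - n%:Z by lia.
  have n0 : n%:Z%:~R = 0 :> 'Z_n by apply/eqP; rewrite intr_Zp_eq0 ?dvdnn.
  by rewrite [in LHS]lE intrB n0 subr0.
by rewrite val_Zp_nat// modn_small//; lia.
Qed.

Definition near (m : nat) (i : 'Z_n) : bool :=
  [exists j : 'I_m.*2.+1, i == ((j : nat)%:Z - m%:Z)%:~R].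

Lemma near_intr (m : nat) (l : int) : (absz l <= m)%N -> near m l%:~R.
Proof.
move=> lm; have lt : (absz (l + m%:Z)%R < m.*2.+1)%N by lia.
apply/existsP; exists (Ordinal lt); apply/eqP; congr (_%:~R) => /=; lia.
Qed.

Lemma nearP (m : nat) (i : 'Z_n) :
  near m i -> exists2 l : int, (absz l <= m)%N & i = l%:~R.
Proof.
move=> /existsP[j /eqP ->]; exists ((j : nat)%:Z - m%:Z) => //.
by have := ltn_ord j; lia.
Qed.

Lemma card_near m : (#|near m| <= m.*2.+1)%N.
Proof.
pose f (j : 'I_m.*2.+1) : 'Z_n := ((j : nat)%:Z - m%:Z)%:~R.
rewrite -[X in (_ <= X)%N]card_ord; apply: leq_trans (leq_image_card f _).
apply: subset_leq_card; apply/fintype.subsetP => i /existsP[j /eqP ->].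
by apply/fintype.imageP; exists j.
Qed.

Lemma nat_val (i : 'Z_n) : i = ((i : nat)%:Z)%:~R.
Proof. by rewrite -[RHS]/(_%:R) natr_Zp. Qed.

Lemma far_notin_near m (l : int) : m%:Z < l -> l + m%:Z < n%:Z ->
  ~~ near m l%:~R.
Proof.
move=> ml ln; apply/negP => /nearP[l' l'm] /eqP.
rewrite -subr_eq0 -intrB intr_Zp_eq0 ?n_gt1// => /dvdn_leq; lia.
Qed.

Context {K : zmodType} {A : groupType} (d : T * 'Z_n -> X -> K) (lambda : K -> A).
Hypothesis d_near : forall t x, near W t.2 -> d t x = 0.

Definition top_step : T * 'Z_n * K -> X * bool -> T * 'Z_n * K :=
  skew cover_step d.

Lemma top_stepK t a : top_step (top_step t a) (letter_inv a) = t.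
Proof. by rewrite /top_step skewK //; exact: cover_stepK. Qed.

(* Crossing level 0 upwards on the sheet j changes the height from 1 to
   lambda j; the representatives in [0, W] are the levels just above 0. *)
Definition height (t : T * 'Z_n * K) : A :=
  if (t.1.2 <= W)%N then lambda t.2 else 1%g.

Lemma height_intr t l j : (absz l <= W)%N ->
  height (t, l%:~R, j) = if 0 <= l then lambda j else 1%g.
Proof. by move=> lW; rewrite /height val_intr. Qed.

(** [height] also jumps between the levels W and W + 1; keeping only the edges that start within [C]
    of level 0 discards that jump. *)
Definition top_label := potential_label top_step height (fun t => near C t.1.2).

(** The path is too short to leave the window, where [d] vanishes; so it stays on the sheet [j], and
    its label is the coboundary of [height]. *)
Lemma wact_near w t l j : (absz l + C * size w <= W)%N ->
  wact top_step (t, l%:~R, j) w =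
    (wact step t w, (l + wsum step c t w)%:~R, j) /\
  wlab top_step top_label (t, l%:~R, j) w =
    ((height (t, l%:~R, j))^-1 *
       height (wact step t w, (l + wsum step c t w)%:~R, j))%g.
Proof.
elim: w t l => [|a w IH] t l; first by rewrite addr0 mulVg.
rewrite /= mulnS => lW; have [e eE eC] : exists2 e : int, cocycle step c t a = e & (absz e <= C)%N.
  by exists (cocycle step c t a); last exact: absz_cocycle.
have leW : (absz (l + e)%R <= W)%N by lia.
have le2 : (absz (l + e)%R + C * size w <= W)%N.
  by move: lW eC; move: (C * size w)%N => N; clear; lia.
have d0 : cocycle cover_step d (t, l%:~R) a = 0.
  have nr : near W (edge cover_step (t, l%:~R) a).1.2.
    rewrite /edge; case: a.2 => /=; first by apply: near_intr; lia.
    by rewrite /cover_step /skew /= cocycle_cmod eE -intrD; exact: near_intr.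
  by rewrite /cocycle d_near//; case: a.2; rewrite ?oppr0.
have stepE : top_step (t, l%:~R, j) a = (step t a, (l + e)%:~R, j).
  by rewrite /top_step /cover_step /skew /= d0 addr0 cocycle_cmod eE -intrD.
rewrite eE wlab_cons stepE; have [-> ->] := IH (step t a) (l + e) le2.
rewrite -addrA; split=> //.
suff -> : top_label (t, l%:~R, j) a =
    ((height (t, l%:~R, j))^-1 * height (step t a, (l + e)%:~R, j))%g.
  by rewrite mulgA mulgK.
rewrite /top_label /potential_label stepE; case: ifPn => //.
have -> : (edge top_step (t, l%:~R, j) a).1.1.2 = (if a.2 then l else l + e)%:~R.
  by rewrite /edge stepE; case: a.2.
(* An edge that starts more than [C] levels from 0 does not change the sign of the level, so the
   coboundary is trivial on it as well. *)
move=> /negP far; have lW' : (absz l <= W)%N by move: lW; clear; lia.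
rewrite !height_intr//.
have : ~ (absz (if a.2 then l else l + e)%R <= C)%N by move=> /near_intr.
case: a.2 => far'; have -> : (0 <= l + e) = (0 <= l) by move: far' eC; clear; lia.
all: by case: ifP => _; rewrite ?mulVg.
Qed.

(** No edge of the path starts within [C] levels of 0, so there is no label, whatever happens to the
    sheet. *)
Lemma wlab_far w t (l : int) j :
  (C + C * size w)%N%:Z < l -> l + (C + C * size w)%N%:Z < n%:Z ->
  wlab top_step top_label (t, l%:~R, j) w = 1%g.
Proof.
elim: w t l j => [//|a w IH] t l j; rewrite /= mulnS => lo hi.
have [e eE eC] : exists2 e : int, cocycle step c t a = e & (absz e <= C)%N.
  by exists (cocycle step c t a); last exact: absz_cocycle.
have [j' stepE] : exists j', top_step (t, l%:~R, j) a = (step t a, (l + e)%:~R, j').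
  by rewrite /top_step /cover_step /skew /= cocycle_cmod eE -intrD; eexists.
have [lo' hi'] : (C + C * size w)%N%:Z < l + e /\ l + e + (C + C * size w)%N%:Z < n%:Z.
  by move: lo hi eC; move: (C * size w)%N => N; clear; lia.
rewrite wlab_cons stepE IH// mulg1.
rewrite /top_label /potential_label stepE; case: ifPn => //.
have -> : (edge top_step (t, l%:~R, j) a).1.1.2 = (if a.2 then l else l + e)%:~R.
  by rewrite /edge stepE; case: a.2.
rewrite (negPf (far_notin_near _ _))//; case: a.2;
  by move: lo hi eC; move: (C * size w)%N => N; clear; lia.
Qed.

Lemma wact_top t j w : (wact top_step (t, j) w).1 = wact cover_step t w.
Proof. exact: (wact_equiv (h := fst)). Qed.

Lemma wact_cover q (i : 'Z_n) w :
  wact cover_step (q, i) w = (wact step q w, i + (wsum step c q w)%:~R).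
Proof. by rewrite /cover_step wact_skew wsum_cmod. Qed.

Lemma wlab_avoids_near t j w :
  avoids cover_step (fun e => near W e.1.2) t w ->
  wlab top_step top_label (t, j) w = 1%g.
Proof.
move=> av; apply: wlab_avoids; elim: w t j av => [//|a w IH] t j /=.
move=> /andP[far /IH {}IH]; rewrite {}IH andbT; move: far; rewrite /edge.
have CW i : near C i -> near W i.
  by move=> /nearP[l lC ->]; apply: near_intr; apply: leq_trans C_le_W.
by case: a.2; apply: contra => /= /CW.
Qed.

Context (M : nat).
Hypothesis C_gt0 : (0 < C)%N.
Hypothesis M_W : ((C * M + C).*2 <= W)%N.

(** [M] bounds the lengths of the words considered; with the margin CM + C, one of [wact_near] and
    [wlab_far] applies from any level. *)
Lemma near_or_far (i : 'Z_n) :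
  (exists2 l : int, (absz l <= C * M + C)%N & i = l%:~R) \/
  ((C * M + C)%N < i)%N /\ (i + (C * M + C) < n)%N.
Proof.
case: (leqP i (C * M + C)) => [lo|lo]; first by left; exists (i : nat)%:Z; rewrite -?nat_val.
case: (ltnP (i + (C * M + C))%N n) => [hi|hi]; [by right|left].
have i_lt : (i < n)%N by have := ltn_ord i; rewrite [X in (_ < X)%N]Zp_cast// n_gt1.
exists ((i : nat)%:Z - n%:Z); first by move: hi i_lt; move: (nat_of_ord i) => l; lia.
have n0 : n%:Z%:~R = 0 :> 'Z_n by apply/eqP; rewrite intr_Zp_eq0 ?dvdnn ?n_gt1.
by rewrite intrB n0 subr0 -nat_val.
Qed.

Lemma wlab_top_far q (i : 'Z_n) j w : (size w <= M)%N ->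
  (C * M + C < i)%N -> (i + (C * M + C) < n)%N ->
  wlab top_step top_label (q, i, j) w = 1%g.
Proof.
move=> wM lo hi; rewrite [X in (_, X, _)]nat_val; apply: wlab_far.
  by have := leq_mul (leqnn C) wM; move: lo; lia.
by have := leq_mul (leqnn C) wM; move: hi; lia.
Qed.

Lemma near_bound (l : int) (w : seq (X * bool)) : (size w <= M)%N ->
  (absz l <= C * M + C)%N -> (absz l + C * size w <= W)%N.
Proof. by move=> wM lB; have := leq_mul (leqnn C) wM; lia. Qed.

Lemma wlab_top_relator q (i : 'Z_n) j w : (size w <= M)%N ->
  wact step q w = q -> wsum step c q w = 0 ->
  wlab top_step top_label (q, i, j) w = 1%g.
Proof.
move=> wM wq w0; have [[l lB ->]|[lo hi]] := near_or_far i.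
  have [_ ->] := wact_near q j (near_bound wM lB).
  by rewrite wq w0 addr0 mulVg.
exact: wlab_top_far.
Qed.

Context (q : T) (u : freeGroup X).
Hypothesis u_M : (size u <= M)%N.
Hypothesis u_q : wact step q u = q.
Hypothesis u_1 : wsum step c q u = 1.

(** The loop [u] raises the level by one. Its label can be non-trivial only from level -1 to level
    0, which l + 1 < n excludes. *)
Lemma climb (l : nat) (j : K) : (l.+1 < n)%N ->
  exists j', wact top_step (q, l%:R, j) u = (q, l.+1%:R, j') /\
    wlab top_step top_label (q, l%:R, j) u = 1%g.
Proof.
move=> l_lt; have n1 := n_gt1.
exists (wact top_step (q, l%:R, j) u).2; split.
  have := wact_top (q, l%:R) j u; rewrite wact_cover u_q u_1.
  by case: (wact _ _ _) => t k /= ->; rewrite -natr1.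
have [[m mB lm]|[lo hi]] := near_or_far (l%:R : 'Z_n); last exact: wlab_top_far.
have m1 : m != -1.
  apply/eqP => m1; have : (l.+1%:R : 'Z_n) = 0 by rewrite -natr1 lm m1 addNr.
  by move=> /(congr1 val); rewrite /= val_Zp_nat// modn_small.
rewrite lm; have [_ ->] := wact_near q j (near_bound u_M mB).
rewrite u_q u_1 !height_intr; last 2 first.
- by move: mB M_W C_gt0; clear; lia.
- by move: mB M_W C_gt0; clear; lia.
have -> : (0 <= m + 1) = (0 <= m) by move: m1; clear; lia.
by case: ifP => _; rewrite ?mulVg.
Qed.

Lemma cross (j : K) :
  wact top_step (q, -1, j) u = (q, 0, j) /\
  wlab top_step top_label (q, -1, j) u = lambda j.
Proof.
have n1 := n_gt1; have lW : (absz (-1 : int) <= C * M + C)%N by lia.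
have [] := wact_near q j (near_bound u_M lW).
rewrite u_q u_1 addNr !height_intr; [|lia|by move: M_W C_gt0; clear; lia].
by rewrite invg1 mul1g mulrN1z.
Qed.

Local Notation upath := (unlabelled_path top_step top_label).

Lemma top_labelV t a : top_label (top_step t a) (letter_inv a) = (top_label t a)^-1%g.
Proof. by rewrite /top_label potential_labelV//; exact: top_stepK. Qed.

Lemma upath_down (l : nat) (j : K) : (l < n)%N ->
  exists j', upath (q, l%:R, j) (q, 0, j').
Proof.
elim: l j => [|l IH] j l_lt.
  by exists j; apply: unlabelled_path_refl.
pose t := wact top_step (q, l.+1%:R, j) (u^-1%g : freeGroup X).
have tE : t = (q, l%:R, t.2).
  have : t.1 = (q, l%:R).
    rewrite /t wact_top -(wactK cover_stepK (q, l%:R) u); congr wact.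
    by rewrite wact_cover u_q u_1 -natr1.
  by case: (t) => t1 t2 /= ->.
have [j1 [tu lab_tu]] := climb t.2 l_lt.
have [j' IH'] := IH t.2 (ltnW l_lt).
exists j'; apply: unlabelled_path_trans IH'; first exact: top_stepK.
  exact: top_labelV.
apply: unlabelled_path_sym; [exact: top_stepK|exact: top_labelV|].
exists u; split; last exact: lab_tu.
by rewrite -tE /t (wactVK top_stepK).
Qed.

Lemma upath_up (l : nat) (j : K) : (l < n)%N ->
  exists j', upath (q, 0, j) (q, l%:R, j').
Proof.
elim: l j => [|l IH] j l_lt.
  by exists j; apply: unlabelled_path_refl.
have [j1 IH1] := IH j (ltnW l_lt); have [j2 [tu lab_tu]] := climb j1 l_lt.
exists j2; apply: unlabelled_path_trans IH1 _; first exact: top_stepK.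
  exact: top_labelV.
by exists u.
Qed.

(** Unlabelled paths lead to level -1 on the sheet [y]; there [u] crosses level 0 with label
    [lambda y], and unlabelled paths lead back. The hypothesis allows changes of sheet at level
    [i]. *)
Lemma loop_labelled (i : 'Z_n) (j0 : K) :
  (forall j j', upath (q, i, j) (q, i, j')) ->
  forall y, exists v : freeGroup X, wact top_step (q, i, j0) v = (q, i, j0) /\
    wlab top_step top_label (q, i, j0) v = lambda y.
Proof.
move=> loops y; have n1 := n_gt1.
have trans := unlabelled_path_trans top_stepK top_labelV.
have sym := unlabelled_path_sym top_stepK top_labelV.
have i_lt : (i < n)%N by have := ltn_ord i; rewrite [X in (_ < X)%N]Zp_cast.
have up j : exists j', upath (q, 0, j) (q, i, j').
  by have [j'] := upath_up j i_lt; rewrite natr_Zp; exists j'.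
have [v1 [p1 l1]] : upath (q, i, j0) (q, -1, y).
  have predn_lt : (n.-1 < n)%N by rewrite prednK// ltnW.
  have [j1] := upath_down y predn_lt.
  have -> : n.-1%:R = -1 :> 'Z_n.
    apply: (addIr 1); rewrite natr1 prednK ?(ltnW n1)// addNr.
    by apply/eqP; rewrite -[_%:R]/(n%:Z%:~R) intr_Zp_eq0 ?dvdnn.
  have [j2 d2] := up j1; move=> d1.
  exact: (trans _ _ _ (loops _ j2) (trans _ _ _ (sym _ _ d2) (sym _ _ d1))).
have [v2 [p2 l2]] : upath (q, 0, y) (q, i, j0).
  by have [j1 d1] := up y; exact: (trans _ _ _ d1 (loops _ _)).
have [p3 l3] := cross y.
exists (v1 * u * v2)%g; rewrite !(wactM top_stepK) p1 p3 p2; split=> //.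
rewrite !(wlabM top_stepK top_labelV) l1 mul1g (wactM top_stepK) p1 p3 l2 l3.
by rewrite mulg1.
Qed.

End CyclicCover.

(** * The labelled action of the free group *)

Section BaumslagPride.
Local Open Scope ring_scope.
Context {X : finType} (p : nat) (s : seq (freeGroup X * nat)).
Context {Q : finGroupType} (phi : freeGroup X -> Q).
Hypothesis p_pr : prime p.
Hypothesis phiM : {morph phi : u v / (u * v)%g}.
Hypothesis pQ : p.-group [set: Q]%SET.
Hypothesis phi_onto : forall q, exists u, phi u = q.
Hypothesis phi_s : kills p phi s.
Let s1 := [seq r <- s | #[phi r.1]%g == (p ^ r.2)%N].
Hypothesis nak : forall (Q' : finGroupType) (phi' : freeGroup X -> Q'),
  is_pquotient p phi' -> kills p phi' s1 -> kills p phi' s.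
Hypothesis deficiency :
  (\sum_(r <- s1) #|Q| %/ p ^ r.2 + #|Q| < #|Q| * #|X|)%N.

Lemma baumslag_pride : exists (T : finType) (step : T -> X * bool -> T)
    (lab : T -> X * bool -> freeGroup 'F_p) (v0 : T),
  [/\ forall t a, step (step t a) (letter_inv a) = t,
      forall t a, lab (step t a) (letter_inv a) = (lab t a)^-1%g,
      exists k, forall (u : freeGroup X) t, wact step t (u ^+ (p ^ k))%g = t,
      forall r t, r \in s -> wact step t (relator p r) = t /\
        wlab step lab t (relator p r) = 1%g
    & forall y, exists u : freeGroup X, wact step v0 u = v0 /\
        wlab step lab v0 u = free_gen y].
Proof.
have s1_s r : r \in s1 -> r \in s by rewrite mem_filter => /andP[].
have [c [c_s1 c_t]] := normalized_cocycle p_pr phiM pQ phi_onto phi_s deficiency.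
have c_s := cocycle_kills_all p_pr phiM pQ phi_s nak c_s1.
have phi_fix q r : r \in s -> wact (stepQ phi) q (relator p r) = q.
  by move=> rs; rewrite (wact_stepQ phiM) phi_s// mulg1.
have [tq tqP] := choice c_t.
pose C := (\max_(e : Q * X) absz (c e.1 e.2)).+1.
have c_le q x : (absz (c q x) <= C)%N.
  by apply: leqW; exact: (leq_bigmax (q, x)).
pose M := maxn (\max_(r <- s) size (relator p r)) (\max_(q : Q) size (tq q)).
(* A path of length at most [M] starting within CM + C of level 0 stays within [W] of it. *)
pose W := (C * M + C).*2.
have C_W : (C <= W)%N by rewrite /W; lia.
(* Makes n = p^k exceed both 2W + 1 and the number of edges near level 0. *)
pose k := (W.*2.+1 * (#|Q| * #|X|) + W.*2.+1)%N; pose n := (p ^ k)%N.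
have n_gt : (k < n)%N by rewrite ltn_expl// prime_gt1.
have W_n : (W.*2.+1 < n)%N by apply: leq_ltn_trans n_gt; rewrite leq_addl.
have n_gt1 := cover_n_gt1 W_n.
pose cstep := cover_step (stepQ phi) c (n := n).
have cstepK t a : cstep (cstep t a) (letter_inv a) = t.
  exact: (cover_stepK (stepQK phi)).
have card_Zn : #|'Z_n| = n by rewrite card_ord Zp_cast.
have fix_c t r : r \in s -> wact cstep t (relator p r) = t.
  by case: t => q i rs; rewrite /cstep wact_cover phi_fix// c_s// addr0.
pose E : pred ((Q * 'Z_n) * X) := fun e => near W e.1.2.
have cardE : (#|E| <= W.*2.+1 * (#|Q| * #|X|))%N.
  have -> : #|E| = #|[predX [predX Q & (near W : pred 'Z_n)] & X]|.
    by apply: eq_card => -[[q i] x]; rewrite !inE andbT.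
  by rewrite !cardX -mulnA mulnCA leq_mul2r card_near orbT.
have cardT2 : #|{: Q * 'Z_n}| = (#|Q| * n)%N by rewrite card_prod card_Zn.
pose s1' := [seq (r.1, (p ^ r.2)%N) | r <- s1].
have [] := @exists_cocycle X _ cstep cstepK 'F_p E s1'.
- move=> _ /mapP[r rs1 ->] /=.
  have [m_gt0 _ m_min] := s1_has_exact_period p_pr phiM phi_s rs1.
  split=> // [t|[q i] j j_lt].
    exact: (fix_c t r (s1_s _ rs1)).
  by rewrite /cstep wact_cover => -[+ _]; exact: m_min.
- rewrite cardT2 big_map.
  have -> : (\sum_(r <- s1) #|Q| * n %/ p ^ r.2 =
      (\sum_(r <- s1) #|Q| %/ p ^ r.2) * n)%N.
    rewrite big_distrl /= big_seq [RHS]big_seq; apply: eq_bigr => r.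
    rewrite mem_filter => /andP[/eqP <- _]; apply/esym/divn_mulAC.
    by rewrite -cardsT order_dvdG// inE.
  (* Multiplied by [n], the strict inequality [deficiency] leaves a gap of at least [n], enough for
     the extra equations that make [d] vanish on [E]. *)
  rewrite -addnA -mulnDl; apply: leq_ltn_trans (leq_add cardE (leqnn _)) _.
  rewrite mulnAC; apply: leq_trans (leq_mul deficiency (leqnn n)).
  rewrite mulSn -addSn leq_add2r; apply: leq_trans n_gt.
  by rewrite ltnS leq_addr.
move=> d [d_E d_s1 d_cob].
have d_near t x : near W t.2 -> d t x = 0 by move=> tW; exact: (d_E (t, x)).
pose top := top_step (stepQ phi) c d.
pose lab := top_label (stepQ phi) c C W d (@free_gen 'F_p).
have topK : forall t a, top (top t a) (letter_inv a) = t.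
  exact: (top_stepK (stepQK phi)).
have labV : forall t a, lab (top t a) (letter_inv a) = (lab t a)^-1%g.
  exact: (top_labelV (stepQK phi)).
have [k0 Qk0] := stepQ_p_exponent phiM pQ.
have top_exp : exists k, forall (u : freeGroup X) t, wact top t (u ^+ (p ^ k))%g = t.
  exists (k0 + k + 1)%N => u t; rewrite expnD expn1 /top /top_step.
  apply: skew_exp_fix.
  - exact: cstepK.
  - move=> t'; rewrite expnD /cover_step; apply: skew_exp_fix => //.
    + exact: stepQK.
    + by move=> i; apply: Zp_mulrn_self.
  - by move=> i; rewrite -mulr_natr pchar_Fp_0// mulr0.
(* The equations for [d] concern only the kept relators; [action_killed] covers the others. *)
have fix_top r t : r \in s -> wact top t (relator p r) = t.
  move: r t; apply: (action_killed p_pr topK _ nak).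
    by move=> u; have [k1 k1P] := top_exp; exists k1.
  move=> r [t j] rs1; rewrite /top /top_step wact_skew.
  have -> : wsum (cover_step (stepQ phi) c (n := n)) d t (relator p r) = 0.
    by apply: (d_s1 (r.1, (p ^ r.2)%N)); exact: (map_f (fun r => (r.1, (p ^ r.2)%N))).
  by rewrite addr0; congr (_, _); exact: fix_c (s1_s _ rs1).
(* As [d] is not a coboundary off [E], some loop away from level 0 has a non-zero sum. *)
have [[q i] [w [w_av w_q w_d]]] : exists v w,
    [/\ avoids cstep E v w, wact cstep v w = v & wsum cstep d v w != 0].
  apply: contrapT => nloop; apply: d_cob.
  apply: (coboundary_of_loops cstepK (1%g, 0)) => t w w_av tw.
  by apply: contrapT => /eqP wd; apply: nloop; exists t, w.
(* That loop is unlabelled and shifts the sheet by an additive generator of ['F_p], so its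
   repetitions join all sheets. *)
have loops j j' : unlabelled_path top lab (q, i, j) (q, i, j').
  pose m := nat_of_ord ((j' - j) / wsum cstep d (q, i) w).
  have -> : j' = j + wsum cstep d (q, i) w *+ m.
    by rewrite -mulr_natr natr_Zp mulrCA divff// mulr1 addrCA subrr addr0.
  elim: m => [|m IH]; first by rewrite mulr0n addr0; exact: unlabelled_path_refl.
  apply: (unlabelled_path_trans topK labV IH); exists (reduce w); split.
    rewrite (wact_reduce _ _ topK) /top /top_step wact_skew -addrA -mulrSr.
    by rewrite [wact _ _ _]w_q.
  by rewrite (wlab_reduce topK labV) wlab_avoids_near.
have q_fix : wact (stepQ phi) q (tq q) = q.
  by rewrite (wact_stepQ phiM); have [-> _] := tqP q; rewrite mulg1.
exists (Q * 'Z_n * 'F_p)%type, top, lab, (q, i, 0); split=> //.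
- move=> r [[q' i'] j] rs; split; first exact: fix_top.
  apply: (@wlab_top_relator X Q (stepQ phi) c C W n c_le C_W W_n _ _ d _ d_near M) => //.
  + rewrite leq_max; apply/orP; left.
    by rewrite (big_rem _ rs) /= leq_max leqnn.
  + exact: phi_fix.
  + exact: c_s.
- move=> y; apply: (@loop_labelled X Q (stepQ phi) (stepQK phi) c C W n c_le C_W W_n
    _ _ d _ d_near M _ _ q (tq q)) => //.
  + rewrite leq_max; apply/orP; right.
    by rewrite (bigD1 q) //= leq_max leqnn.
  + by have [] := tqP q.
Qed.

End BaumslagPride.

(** * Free quotients of subgroups of p-power index *)

(* The vertices of the coset graph of D are the right cosets of D, coded as
   sets; the only labelled edges are those leaving the vertex D, so a minimal
   power of a generator y in D has label y. *)
Section CosetLabels.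
Context {Y : choiceType} (D : set (freeGroup Y)).

Definition coset_step (A : set (freeGroup Y)) (a : Y * bool) : set (freeGroup Y) :=
  [set z * free_letter a | z in A].

Definition coset_label (A : set (freeGroup Y)) (a : Y * bool) : freeGroup Y :=
  if `[< (edge coset_step A a).1 = D >] then free_letter a else 1.

Lemma coset_stepK A a : coset_step (coset_step A a) (letter_inv a) = A.
Proof.
rewrite /coset_step image_comp /= free_letterV.
by rewrite (eq_imagel (f' := id)) ?image_id// => z _ /=; rewrite mulgK.
Qed.

Lemma coset_labelV A a :
  coset_label (coset_step A a) (letter_inv a) = (coset_label A a)^-1.
Proof.
rewrite /coset_label (edge_inv coset_stepK) free_letterV.
by case: asboolP => _; rewrite ?invg1.
Qed.

Lemma wact_coset A (u : freeGroup Y) : wact coset_step A u = [set z * u | z in A].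
Proof.
move: u A; apply: freeGroup_ind => [|a u IH] A.
  by rewrite /= (eq_imagel (f' := id)) ?image_id// => z _; rewrite mulg1.
rewrite (wactM coset_stepK) IH /= /coset_step image_comp.
by apply: eq_imagel => z _ /=; rewrite mulgA.
Qed.

Hypothesis Dg : group_closed [in D].

Let D1 : D 1. Proof. by case: Dg => /set_mem. Qed.
Let DM x y : D x -> D y -> D (x * y).
Proof. by move=> Dx Dy; apply/set_mem/(group_closedM Dg); apply/mem_set. Qed.
Let DV x : D x -> D x^-1.
Proof. by move=> Dx; apply/set_mem/(group_closedV Dg); apply/mem_set. Qed.

Lemma wact_cosetP (u : freeGroup Y) : wact coset_step D u = D <-> D u.
Proof.
rewrite wact_coset; split=> [<-|Du]; first by exists 1; rewrite ?mul1g.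
apply/seteqP; split=> [_ [z Dz <-]|z Dz]; first exact: DM.
by exists (z * u^-1); [apply: DM => //; exact: DV|rewrite mulgVK].
Qed.

Lemma wlab_coset_gen y j :
  (forall i, (0 < i <= j)%N -> ~ D (free_gen y ^+ i)) ->
  wlab coset_step coset_label D (free_gen y ^+ j.+1) = free_gen y.
Proof.
have lab_gen A : wlab coset_step coset_label A (free_gen y) =
    if `[< A = D >] then free_gen y else 1.
  by rewrite -[word_of (free_gen y)]/[:: (y, true)] wlab_cons mulg1.
elim: j => [_|j IH notD]; first by rewrite lab_gen asboolT.
rewrite expgSr (wlabM coset_stepK coset_labelV) IH ?lab_gen; last first.
  by move=> i /andP[i0 ij]; apply: notD; rewrite i0 leqW.
by rewrite asboolF ?mulg1// => /wact_cosetP; apply: notD; rewrite /= leqnn.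
Qed.

(** The label is multiplicative on [D], the stabilizer of the vertex [D], and every generator is the
    label of one of its own powers. *)
Lemma free_image_of_subgroup :
  (forall y, exists n, (0 < n)%N /\ D (free_gen y ^+ n)) ->
  exists theta : freeGroup Y -> freeGroup Y,
    {in D &, {morph theta : x y / x * y}} /\ theta @` D = [set: freeGroup Y].
Proof.
move=> Dexp; pose theta u := wlab coset_step coset_label D (word_of u).
have thetaM x y : D x -> theta (x * y) = theta x * theta y.
  by move=> /wact_cosetP Dx; rewrite /theta (wlabM coset_stepK coset_labelV) Dx.
exists theta; split; first by move=> x y /set_mem Dx _; exact: thetaM.
apply/seteqP; split=> // u _; move: u; apply: subgroup_free_full.
  split; first by apply/mem_set; exists 1.
  move=> _ _ /set_mem[x Dx <-] /set_mem[y Dy <-]; apply/mem_set.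
  exists (x * y^-1); first by apply: DM => //; exact: DV.
  rewrite thetaM//; congr (_ * _); apply/esym/mulg1_eq.
  by rewrite -thetaM// mulgV.
move=> y; have exP : exists n, `[< (0 < n)%N /\ D (free_gen y ^+ n) >].
  by have [n nP] := Dexp y; exists n; apply/asboolP.
case: (ex_minnP exP) => -[|n] /asboolP[// n_gt0 Dn] nmin.
exists (free_gen y ^+ n.+1) => //; apply: wlab_coset_gen => i /andP[i_gt0 i_le] Di.
by have := nmin i (asboolT (conj i_gt0 Di)); rewrite leqNgt ltnS i_le.
Qed.

End CosetLabels.

Lemma trivial_on_normal_closure (X : choiceType) (T : Type)
    (step : T -> X * bool -> T) (R : set (freeGroup X)) :
  (forall t a, step (step t a) (letter_inv a) = t) ->
  (forall r t, R r -> wact step t r = t) ->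
  forall u t, normal_closure R u -> wact step t u = t.
Proof.
move=> stepK R_triv u t; move/(_ [set u : freeGroup X | forall t, wact step t u = t]).
move=> /(_ _); apply; split=> [|r Rr]; last by move=> t'; exact: R_triv.
split; first split.
- by apply/mem_set.
- move=> x y /set_mem xT /set_mem yT; apply/mem_set => t'.
  by rewrite (wactM stepK) xT -{1}[t']yT (wactK stepK).
- move=> g x xT t'; rewrite /conjg !(wactM stepK) xT.
  by rewrite (wactVK stepK).
Qed.

(** Action and labels descend to [G]. The kernel [H] of the action of [G] has p-power index, and the
    labels at [v0] map it onto a subgroup [D] containing a power of each generator, so
    [free_image_of_subgroup] applies. *)
Lemma plarge_of_labelled_action (p : nat) (G : groupType) (X : choiceType)
    (f : {multiplicative freeGroup X -> G}) (T : finType)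
    (step : T -> X * bool -> T) (Y : choiceType)
    (lab : T -> X * bool -> freeGroup Y) (v0 : T) (k : nat) :
  prime p -> range f = [set: G] ->
  (forall t a, step (step t a) (letter_inv a) = t) ->
  (forall t a, lab (step t a) (letter_inv a) = (lab t a)^-1) ->
  (forall (u : freeGroup X) t, wact step t (u ^+ (p ^ k)) = t) ->
  (forall u t, f u = 1 -> wact step t u = t /\ wlab step lab t u = 1) ->
  (forall y, exists u : freeGroup X, wact step v0 u = v0 /\
        wlab step lab v0 u = free_gen y) ->
  (exists y1 y2 : Y, y1 != y2) ->
  plarge p G.
Proof.
move=> p_pr f_onto stepK labV p_exp f_ker loops [y1 [y2 y12]].
have fM : {morph f : u v / u * v} by exact: gmulfM.
have ex_sect g : exists u, f u = g.
  have [u _ <-] : range f g by rewrite f_onto.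
  by exists u.
have [sect sectK] := choice ex_sect.
have same u v t : f u = f v ->
    wact step t u = wact step t v /\ wlab step lab t u = wlab step lab t v.
  move=> fuv; have /(f_ker _ t)[tuv luv] : f (u * v^-1) = 1.
    by rewrite fM (morph_inv fM) fuv mulgV.
  have -> : u = (u * v^-1) * v by rewrite mulgVK.
  by rewrite (wactM stepK) (wlabM stepK labV) tuv luv mul1g.
have sectM g h t : wact step t (sect (g * h)) = wact step (wact step t (sect g)) (sect h).
  rewrite -(wactM stepK); apply: (proj1 (same _ _ _ _)).
  by rewrite fM !sectK.
have labM g h t : wlab step lab t (sect (g * h)) =
    wlab step lab t (sect g) * wlab step lab (wact step t (sect g)) (sect h).
  rewrite -(wlabM stepK labV); apply: (proj2 (same _ _ _ _)).
  by rewrite fM !sectK.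
have sectV g t : wact step (wact step t (sect g)) (sect g^-1) = t.
  by rewrite -sectM mulgV; have [-> //] := f_ker (sect 1) t (sectK 1).
pose H := [set g | forall t, wact step t (sect g) = t].
have HV g : H g -> H g^-1 by move=> Hg t; rewrite -{1}[t]Hg sectV.
have HM g h : H g -> H h -> H (g * h) by move=> Hg Hh t; rewrite sectM Hg Hh.
have H1 : H 1 by move=> t; have [-> //] := f_ker (sect 1) t (sectK 1).
have H_normal : normal_subgroup H.
  split; first split.
  - exact/mem_set.
  - move=> g h /set_mem Hg /set_mem Hh; apply/mem_set; apply: HM => //; exact: HV.
  - move=> g h Hh t; rewrite /conjg sectM sectM Hh.
    by have := sectV g^-1 t; rewrite invgK.
pose rho g := wperm stepK (sect g).
have rhoE g t : rho g t = wact step t (sect g) by exact: wpermE.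
have rhoM : {morph rho : g h / g * h}.
  by move=> g h; apply/permP => t; rewrite permM !rhoE sectM.
have rho1P g : rho g = 1 <-> H g.
  split=> [h t|Hg]; first by rewrite -rhoE h perm1.
  by apply/permP => t; rewrite rhoE perm1 Hg.
pose P := [set x : {perm T} | `[< exists g, rho g = x >]]%SET.
have PP x : reflect (exists g, rho g = x) (x \in P) by rewrite inE; exact: asboolP.
have gP : group_set P.
  apply/group_setP; split; first by apply/PP; exists 1; exact: morph1_id.
  by move=> x y /PP[g <-] /PP[h <-]; apply/PP; exists (g * h); rewrite rhoM.
have [m cardP] : exists m, #|P| = (p ^ m)%N.
  have : p.-group (group gP).
    apply: pgroup_p_elt => _ /PP[g <-]; apply: (@pnat_dvd _ (p ^ k)).
      rewrite order_dvdn; apply/eqP/permP => t; rewrite perm1.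
      rewrite -(morph_exp _ rhoM) rhoE.
      rewrite -[RHS](p_exp (sect g)); apply: (proj1 (same _ _ _ _)).
      by rewrite (morph_exp _ fM) !sectK.
    by rewrite pnatX pnat_id.
  by move=> /p_natP[m]; exists m.
have H_index : has_index H (p ^ m).
  (* The left cosets of [H] are the fibres of [rho], indexed by its image [P]. *)
  rewrite /has_index -cardP; pose F (i : 'I_#|P|) : set G := [set g | rho g = enum_val i].
  have -> : left_cosets H = F @` [set: 'I_#|P|].
    apply/seteqP; split=> [_ [g _ <-]|_ [i _ <-]].
      have Pg : rho g \in P by apply/PP; exists g.
      exists (enum_rank_in Pg (rho g)) => //.
      rewrite /F enum_rankK_in//; apply/seteqP; split=> [g' g'g|_ [h Hh <-]] /=.
        exists (g^-1 * g'); last by rewrite mulVKg.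
        by apply/rho1P; rewrite rhoM g'g -rhoM mulVg (morph1_id rhoM).
      by rewrite rhoM; move/rho1P: Hh => ->; rewrite mulg1.
    have /PP[g gi] := enum_valP i; exists g => //.
    rewrite /F -gi; apply/seteqP; split=> [_ [h Hh <-]|g' g'g] /=.
      by rewrite rhoM; move/rho1P: Hh => ->; rewrite mulg1.
    exists (g^-1 * g'); last by rewrite mulVKg.
    by apply/rho1P; rewrite rhoM g'g -rhoM mulVg (morph1_id rhoM).
  have F_inj : (F @` [set: 'I_#|P|] #= [set: 'I_#|P|])%card.
    apply: inj_card_eq => i j _ _ Fij; apply: enum_val_inj.
    have /PP[g gi] := enum_valP i.
    by have : F i g by []; rewrite Fij /F /= gi.
  by rewrite (card_eql F_inj) card_eq_sym card_II.
pose psi g := wlab step lab v0 (sect g).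
have psiM g h : H g -> psi (g * h) = psi g * psi h.
  by move=> Hg; rewrite /psi labM Hg.
pose D := psi @` H.
have Dg : group_closed [in D].
  split.
    apply/mem_set; exists 1 => //.
    exact: (proj2 (f_ker (sect 1) v0 (sectK 1))).
  move=> _ _ /set_mem[g Hg <-] /set_mem[h Hh <-]; apply/mem_set.
  exists (g * h^-1); first by apply: HM => //; exact: HV.
  rewrite psiM//; congr (_ * _); apply/esym/mulg1_eq.
  by rewrite -psiM// mulgV; exact: (proj2 (f_ker (sect 1) v0 (sectK 1))).
have [|theta [thetaM theta_onto]] := free_image_of_subgroup Dg.
  (* The loop labelled [y] need not act trivially, but its p^k-th power does. *)
  move=> y; have [u [uv0 uy]] := loops y; exists (p ^ k)%N.
  split; first by rewrite expn_gt0 prime_gt0.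
  have fu : f (sect (f (u ^+ (p ^ k)))) = f (u ^+ (p ^ k)) by rewrite sectK.
  exists (f (u ^+ (p ^ k))).
    by move=> t; rewrite (proj1 (same _ _ t fu)).
  by rewrite /psi (proj2 (same _ _ v0 fu)) (wlab_exp stepK labV)// uy.
exists H, m; split=> //; exists Y, (theta \o psi); split.
- move=> g h /set_mem Hg /set_mem Hh /=; rewrite psiM// thetaM//.
    by apply/mem_set; exists g.
  by apply/mem_set; exists h.
- by rewrite -theta_onto /D image_comp.
- exists (free_gen y1), (free_gen y2) => /(congr1 val) /=.
  by rewrite /push /= /letter_inv /= !xpair_eqE !andbF => -[/eqP + _]; rewrite (negPf y12).
Qed.

(** * Finitely many relators suffice *)

Section NormalSubgroup.
Context {G : groupType}.

Lemma normal_subgroupP (H : set G) :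
  H 1 -> (forall x y, H x -> H y -> H (x * y)) -> (forall x, H x -> H x^-1) ->
  (forall x g, H x -> H (x ^ g)) -> normal_subgroup H.
Proof.
move=> H1 HM HV HJ; split; last by move=> g x; exact: HJ.
split=> [|x y /set_mem Hx /set_mem Hy]; apply/mem_set => //.
by apply: HM => //; exact: HV.
Qed.

Lemma normal_closure_normal (A : set G) : normal_subgroup (normal_closure A).
Proof.
apply: normal_subgroupP => [M [[/= [M1 _] _] _]|x y xA yA M MA|x xA M MA|x g xA M MA].
- exact: set_mem M1.
- have [[Mg _] _] := MA; apply/set_mem/(group_closedM Mg); apply/mem_set.
    exact: xA.
  exact: yA.
- have [[Mg _] _] := MA; apply/set_mem/(group_closedV Mg); apply/mem_set.
  exact: xA.
- by have [[_ MJ] _] := MA; apply: MJ; exact: xA.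
Qed.

Lemma normal1 (H : set G) : normal_subgroup H -> H 1.
Proof. by case=> -[/set_mem]. Qed.

Lemma normalM (H : set G) x y : normal_subgroup H -> H x -> H y -> H (x * y).
Proof.
by case=> Hg _ Hx Hy; apply/set_mem/(group_closedM Hg); apply/mem_set.
Qed.

Lemma normalV (H : set G) x : normal_subgroup H -> H x -> H x^-1.
Proof. by case=> Hg _ Hx; apply/set_mem/(group_closedV Hg); apply/mem_set. Qed.

Lemma normalJ (H : set G) x g : normal_subgroup H -> H x -> H (x ^ g).
Proof. by case=> _; apply. Qed.

Lemma sub_normal_closure (A B : set G) :
  A `<=` B -> normal_closure A `<=` normal_closure B.
Proof.
by move=> AB; apply: sub_smallest2r AB; exact: normal_closure_normal.
Qed.

(** The elements lying in the normal closure of finitely many members of [R] form a normal subgroup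
    containing [R]. *)
Lemma normal_closure_finitary (R : set G) (A : seq G) :
  (forall a, a \in A -> normal_closure R a) ->
  exists rs : seq G, (forall r, r \in rs -> R r) /\
    forall a, a \in A -> normal_closure [set` rs] a.
Proof.
have cat_mono (rs rs' : seq G) :
    normal_closure [set` rs] `<=` normal_closure [set` rs ++ rs'] /\
    normal_closure [set` rs'] `<=` normal_closure [set` rs ++ rs'].
  by split; apply: sub_normal_closure => x /= xrs; rewrite mem_cat xrs ?orbT.
have catR (rs rs' : seq G) : (forall r, r \in rs -> R r) ->
    (forall r, r \in rs' -> R r) -> forall r, r \in rs ++ rs' -> R r.
  by move=> rsR rs'R r; rewrite mem_cat => /orP[/rsR|/rs'R].
elim: A => [|a A IH] AR; first by exists [::].
have [|rs [rsR rsA]] := IH; first by move=> b bA; apply: AR; rewrite inE bA orbT.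
have [rs' [rs'R rs'a]] : exists rs : seq G, (forall r, r \in rs -> R r) /\
    normal_closure [set` rs] a.
  pose M := [set u | exists rs : seq G, (forall r, r \in rs -> R r) /\
    normal_closure [set` rs] u].
  apply: (AR a (mem_head _ _) M); split; last first.
    move=> r Rr; exists [:: r]; split; first by move=> x /[!inE] /eqP ->.
    by apply: sub_gen_smallest; rewrite /= mem_head.
  apply: normal_subgroupP.
  - exists [::]; split=> //.
    exact: (normal1 (normal_closure_normal _)).
  - move=> x y [rs1 [rs1R rs1x]] [rs2 [rs2R rs2y]]; exists (rs1 ++ rs2).
    split; first exact: catR.
    have [s1 s2] := cat_mono rs1 rs2.
    exact: (normalM (normal_closure_normal _) (s1 _ rs1x) (s2 _ rs2y)).
  - move=> x [rs1 [rs1R rs1x]]; exists rs1; split=> //.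
    exact: (normalV (normal_closure_normal _) rs1x).
  - move=> x g [rs1 [rs1R rs1x]]; exists rs1; split=> //.
    exact: (normalJ g (normal_closure_normal _) rs1x).
exists (rs' ++ rs); split; first exact: catR.
have [s1 s2] := cat_mono rs' rs.
by move=> b; rewrite inE => /predU1P[->|/rsA]; [exact: s1|exact: s2].
Qed.

End NormalSubgroup.

(** A finite presentation and the two changes of generators give a finite set whose normal closure
    is the kernel of [f]; each of its elements involves finitely many members of [R]. *)
Lemma finitely_many_relators (G : groupType) (X : finType)
    (R : set (freeGroup X)) (f : {multiplicative freeGroup X -> G}) :
  finitely_presented G -> range f = [set: G] ->
  f @^-1` [set 1] = normal_closure R ->
  exists rs : seq (freeGroup X), (forall r, r \in rs -> R r) /\
    forall u, f u = 1 -> normal_closure [set` rs] u.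
Proof.
move=> [X' [S [finS [f' [f'_onto f'_ker]]]]] f_onto f_ker.
have fM : {morph f : u v / u * v} by exact: gmulfM.
have f'M : {morph f' : u v / u * v} by exact: gmulfM.
have onto g : exists u, f u = g.
  have [u _ <-] : range f g by rewrite f_onto.
  by exists u.
have onto' g : exists u, f' u = g.
  have [u _ <-] : range f' g by rewrite f'_onto.
  by exists u.
have [a aE] := choice (fun x : X => onto' (f (free_gen x))).
have [b bE] := choice (fun x : X' => onto (f' (free_gen x))).
pose alpha := free_lift a; pose beta := free_lift b.
have alphaM : {morph alpha : u v / u * v} := free_liftM a.
have betaM : {morph beta : u v / u * v} := free_liftM b.
have f_alpha u : f' (alpha u) = f u.
  apply: (free_morph_ext (f := f' \o alpha)) => [x y|x y|x] /=.
  - by rewrite alphaM f'M.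
  - exact: fM.
  - by rewrite /alpha free_lift_gen aE.
have f_beta u : f (beta u) = f' u.
  apply: (free_morph_ext (f := f \o beta)) => [x y|x y|x] /=.
  - by rewrite betaM fM.
  - exact: f'M.
  - by rewrite /beta free_lift_gen bE.
have /finite_seqP[sS sSE] := finS.
pose A := [seq beta v | v <- sS] ++
  [seq (free_gen x)^-1 * beta (alpha (free_gen x)) | x <- enum X].
have kerf u : f u = 1 -> normal_closure R u by move=> fu; rewrite -f_ker.
have [v|rs [rsR rsA]] := @normal_closure_finitary _ R A.
  rewrite mem_cat => /orP[/mapP[w wS ->]|/mapP[x _ ->]]; apply: kerf.
    rewrite f_beta; apply: (_ : (f' @^-1` [set 1]) w).
    by rewrite f'_ker; apply: sub_gen_smallest; rewrite sSE.
  by rewrite fM (morph_inv fM) f_beta f_alpha mulVg.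
exists rs; split=> // u fu; pose N := normal_closure [set` rs].
have Nn : normal_subgroup N := normal_closure_normal _.
have N_ba v : N (v^-1 * beta (alpha v)).
  move: v; apply: subgroup_free_full; last first.
    move=> x; apply: rsA; rewrite mem_cat; apply/orP; right.
    by apply/mapP; exists x; rewrite ?mem_enum.
  split.
    apply/mem_set; rewrite /= (morph1_id alphaM) (morph1_id betaM) mulVg.
    exact: normal1.
  move=> x y /set_mem Nx /set_mem Ny; apply/mem_set => /=.
  rewrite alphaM betaM (morph_inv alphaM) (morph_inv betaM).
  have := normalJ y^-1 Nn (normalM Nn Nx (normalV Nn Ny)).
  by rewrite /conjg !invMg !invgK !mulgA mulgK.
have N_beta v : f' v = 1 -> N (beta v).
  move=> fv; have : normal_closure S v by rewrite -f'_ker.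
  move/(_ [set v | N (beta v)]); apply; split; last first.
    by move=> w; rewrite sSE => wS; apply: rsA; rewrite mem_cat map_f.
  apply: normal_subgroupP => /=.
  - by rewrite (morph1_id betaM); exact: (normal1 Nn).
  - by move=> x y Nx Ny; rewrite betaM; exact: (normalM Nn).
  - by move=> x Nx; rewrite (morph_inv betaM); exact: (normalV Nn).
  - move=> x g Nx; rewrite /conjg !betaM (morph_inv betaM).
    exact: (normalJ (beta g) Nn Nx).
(* Modulo [N] the element [u] equals [beta (alpha u)], and [alpha u] lies in the kernel of [f']. *)
have -> : u = beta (alpha u) * (u^-1 * beta (alpha u))^-1.
  by rewrite invMg invgK mulVKg.
by apply: (normalM Nn); [apply: N_beta; rewrite f_alpha|exact: (normalV Nn)].
Qed.

(** * The deficiency count *)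

Section Deficiency.
Local Open Scope ring_scope.

(** In the default case [nu] is 0 and [r] is its own root. *)
Lemma exists_nu_root (p : nat) (X : choiceType) (r : freeGroup X) :
  exists w : freeGroup X, (w ^+ (p ^ nu p r))%g = r.
Proof.
rewrite /nu; set E := [set k | exists w, _]; case: xgetP => [k _ []|_]//.
by exists r.
Qed.

Lemma relator_weight_ge0 (K : realType) (p : nat) (X : choiceType)
    (r : freeGroup X) : 0 <= relator_weight K p r.
Proof.
by rewrite /relator_weight; case: ifP => // _; rewrite invr_ge0 exprn_ge0.
Qed.

Lemma pdeficiency_gt1 (K : realType) (p : nat) (X : finType)
    (R : set (freeGroup X)) (rs : seq (freeGroup X)) :
  (1 < pdeficiency K p R)%E -> uniq rs -> (forall r, r \in rs -> R r) ->
  1 + \sum_(r <- rs) relator_weight K p r < #|X|%:R.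
Proof.
move=> def_gt1 rs_uniq rsR; rewrite -lte_fin EFinD -sumEFin.
have le_sum : (\sum_(r <- rs) (relator_weight K p r)%:E <=
    \esum_(r in R) (relator_weight K p r)%:E)%E.
  apply: esum_ge; exists [set` rs]; first by split; [exact: finite_seq|exact: rsR].
  by rewrite (fsbig_seq _ _ rs_uniq).
have : (0 <= \esum_(r in R) (relator_weight K p r)%:E)%E.
  by apply: esum_ge0 => r _; rewrite lee_fin relator_weight_ge0.
move: def_gt1 le_sum; rewrite /pdeficiency.
(* An infinite sum would make the deficiency -oo, so only the finite case remains. *)
case: (\esum_(r in R) _)%E => [x||] //= def_gt1 le_sum _.
by apply: le_lt_trans (leeD2l _ le_sum) _; rewrite -EFinD lte_fin -ltrBrDr -lte_fin.
Qed.

(** Multiply by #|Q| and drop the relators that are not kept. The quotients #|Q| / p^k are exact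
    because p^k is the order of an element of [Q]. *)
Lemma deficiency_count (K : realType) (p : nat) (X : finType)
    (Q : finGroupType) (phi : freeGroup X -> Q) (s : seq (freeGroup X * nat)) :
  prime p ->
  1 + \sum_(r <- s) (p%:R ^- r.2 : K) < #|X|%:R ->
  (\sum_(r <- [seq r <- s | #[phi r.1]%g == (p ^ r.2)%N]) #|Q| %/ p ^ r.2 + #|Q| <
     #|Q| * #|X|)%N.
Proof.
move=> p_pr def_gt1; rewrite -(ltr_nat K) natrD natrM natr_sum.
have Q_gt0 : (0 : K) < #|Q|%:R by rewrite ltr0n; apply/card_gt0P; exists 1%g.
rewrite -(ltr_pM2l Q_gt0) mulrDr mulr1 addrC in def_gt1.
apply: le_lt_trans def_gt1; rewrite lerD2r mulr_sumr big_filter.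
rewrite [leRHS](bigID (fun r => #[phi r.1]%g == (p ^ r.2)%N)) /= -[leLHS]addr0.
apply: lerD.
  apply: ler_sum => r /eqP ord; rewrite natf_div ?natrX//.
  by rewrite -ord -cardsT order_dvdG// inE.
by apply: sumr_ge0 => r _; rewrite mulr_ge0 ?ler0n// invr_ge0 exprn_ge0.
Qed.

End Deficiency.

(** * From p-deficiency to p-largeness *)

Local Open Scope ereal_scope.

Theorem theorem2p2 (K : realType) (p : nat) (G : groupType) (X : finType)
    (R : set (freeGroup X)) :
  prime p -> finitely_presented G -> presented_by G R ->
  1 < pdeficiency K p R -> plarge p G.
Proof.
move=> p_pr G_fp [f [f_onto f_ker]] def_gt1.
have [rs0 [rs0R rs0_ker]] := finitely_many_relators G_fp f_onto f_ker.
pose rs := undup rs0.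
have rsR r : r \in rs -> R r by rewrite mem_undup; exact: rs0R.
have [root rootE] := choice (@exists_nu_root p X).
(* The trivial relator is dropped: its weight is 0, whereas the default [nu] = 0 would make it count
   as 1 in [s_def]. *)
pose s := [seq (root r, nu p r) | r <- rs & r != 1%g].
have relE r : relator p (root r, nu p r) = r by exact: rootE.
have s_def : (1 + \sum_(r <- s) (p%:R ^- r.2 : K) < #|X|%:R)%R.
  apply: le_lt_trans (pdeficiency_gt1 def_gt1 (undup_uniq rs0) rsR).
  rewrite lerD2l big_map big_filter [leRHS](bigID (fun r => r != 1%g)) /=.
  rewrite -[leLHS]addr0; apply: lerD; last first.
    by apply: sumr_ge0 => r _; exact: relator_weight_ge0.
  by apply: ler_sum => r r1; rewrite /relator_weight (negPf r1).
have [Q0 [phi0 [phi0_p phi0_s phi0_max]]] := max_pquotient p_pr s.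
have nak := nakayama p_pr phi0_p phi0_s phi0_max.
have [phi0M pQ0] := phi0_p.
(* [phi] is made onto so that the Cayley graph is connected. *)
have [|Q [phi [phiM pQ phi_onto phi_ord phi_1]]] :=
    @corestriction _ _ phi0 p phi0M.
  by move=> u; apply: mem_p_elt pQ0 _; rewrite inE.
have phi_s : kills p phi s by move=> r rs1; apply/phi_1/phi0_s.
have s1E : [seq r <- s | #[phi r.1] == (p ^ r.2)%N] =
    [seq r <- s | #[phi0 r.1] == (p ^ r.2)%N].
  by apply: eq_filter => r; rewrite phi_ord.
rewrite -s1E in nak.
have [T [step [lab [v0 [stepK labV [k p_exp] s_triv loops]]]]] :=
  baumslag_pride p_pr phiM pQ phi_onto phi_s nak (deficiency_count phi p_pr s_def).
apply: (plarge_of_labelled_action (f := f) (v0 := v0) p_pr f_onto stepK labV p_exp _ loops).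
  move=> u t fu; have stepK' := lstepK stepK labV.
  (* Trivial action and trivial labels together say that [u] fixes the points of [T] times the free
     group, a property that passes from the relators to their normal closure. *)
  have triv : wact (lstep step lab) (t, 1%g) u = (t, 1%g).
    apply: (trivial_on_normal_closure stepK' _ _ (rs0_ker u fu)) => r [t' b] rrs.
    have [->|r1] := eqVneq r 1%g; first by [].
    have [] := s_triv (root r, nu p r) t'.
      by apply: map_f; rewrite mem_filter r1 mem_undup.
    by rewrite relE wact_lstep => -> ->; rewrite mulg1.
  by move: triv; rewrite wact_lstep mul1g => -[-> ->].
by exists 0%R, 1%R; rewrite eq_sym oner_eq0.
Qed.
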